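(* Let $k$ be an algebraically closed field of characteristic $2$ and let $X \subset \mathbb{P}^5_k$ be the Fermat hypersurface of degree $5$ defined by $X_0^5 + X_1^5 + X_2^5 + X_3^5 + X_4^5 + X_5^5 = 0$. Then: (1) every free rational curve $\varphi : \mathbb{P}^1 \to X$ has degree $\geq 8$, and there exists a free rational curve $\varphi : \mathbb{P}^1 \to X$ of degree $8$; (2) every very free rational curve $\varphi : \mathbb{P}^1 \to X$ has degree $\geq 9$, and there exists a very free rational curve $\varphi : \mathbb{P}^1 \to X$ of degree $9$.
   Context: A rational curve on $X$ is a nonconstant morphism $\varphi : \mathbb{P}^1_k \to X$ over $k$. Its degree is the integer $d$ with $\varphi^*\mathcal{O}_X(1) \cong \mathcal{O}_{\mathbb{P}^1}(d)$; equivalently, $\varphi$ is given by a $6$-tuple $(G_0,\ldots,G_5)$ of homogeneous polynomials of degree $d$ in $k[S,T]$ with no common factor and with $G_0^5+\cdots+G_5^5=0$. The variety $X$ is smooth of dimension $4$; write $T_X$ for its tangent bundle and choose a splitting $\varphi^*T_X \cong \bigoplus_{i=1}^4 \mathcal{O}_{\mathbb{P}^1}(a_i)$. The curve $\varphi$ is free if $a_i \geq 0$ for all $i$, and very free if $a_i > 0$ for all $i$. *)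

(* Defs.v *)
From HB Require Import structures.
From mathcomp Require Import all_boot all_order all_algebra.
From mathcomp Require Export mpoly.

Set Implicit Arguments.
Unset Strict Implicit.
Unset Printing Implicit Defensive.

Import GRing.Theory.
Local Open Scope ring_scope.

(* The function field of the affine cone k^2 over P^1.  Rational sections of  *)
(* O(a) on P^1 are its elements of the form P / Q with P, Q homogeneous and   *)
(* deg P - deg Q = a.                                                         *)
Notation coneField k := {fraction {mpoly k[2]}}.

Section P1.

Variable k : closedFieldType.

(* Homogeneous coordinates of a closed point of P^1. *)
Definition P1_point (p : 'I_2 -> k) : Prop := exists i, p i != 0.

(* The stalk O(a)_p of the line bundle O(a) on P^1; for a = 0 this is the     *)
(* local ring of P^1 at p.                                                    *)
Definition O_stalk (a : int) (p : 'I_2 -> k) (f : coneField k) : Prop :=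
  exists (m n : nat) (P Q : {mpoly k[2]}),
    [/\ P \is m.-homog, Q \is n.-homog, m%:Z - n%:Z = a, Q.@[p] != 0
      & f = tofrac P / tofrac Q].

(* The stalk at p of O(a_0) (+) ... (+) O(a_(r-1)). *)
Definition sumO_stalk (r : nat) (a : 'I_r -> int) (p : 'I_2 -> k)
    (c : 'rV[coneField k]_r) : Prop :=
  forall i, O_stalk (a i) p (c ord0 i).

End P1.

Section RationalCurves.

Variables (k : closedFieldType) (n : nat).
(* A form F defines the hypersurface X = {F = 0} in P^(n-1). *)
Variable F : {mpoly k[n]}.

(* The binary forms G_0, ..., G_(n-1) of degree d define a nonconstant        *)
(* morphism phi = [G_0 : ... : G_(n-1)] : P^1 -> X of degree d.               *)
Definition rational_curve (d : nat) (G : 'I_n -> {mpoly k[2]}) : Prop :=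
  [/\ forall i, G i \is d.-homog,
      forall P : {mpoly k[2]},
        (forall i, exists Q, G i = P * Q) -> P \is a GRing.unit,
      F \mPo [tuple G i | i < n] = 0
    & exists p q : 'I_2 -> k, [/\ P1_point p, P1_point q
        & exists i j, (G i).@[p] * (G j).@[q] != (G j).@[p] * (G i).@[q]]].

Variable G : 'I_n -> {mpoly k[2]}.

(* The pullback of X_i / X_j to P^1. *)
Definition ratio_coord (j i : 'I_n) : coneField k := tofrac (G i) / tofrac (G j).

(* The value of the partial derivative dF/dX_i at the point of the affine     *)
(* chart X_j = 1 with coordinates (ratio_coord j l)_l.                        *)
Definition partial_at (j i : 'I_n) : coneField k :=
  mmap (fun c : k => tofrac (c%:MP_[2])) (ratio_coord j) (F^`M(i)).

(* A rational section of phi^* T_X, i.e. a derivation D along phi.  It is     *)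
(* recorded in all the affine charts of X meeting the image of phi: V j i is  *)
(* the value D (X_i / X_j), so that row j of V is a vector field along phi    *)
(* tangent to the affine hypersurface obtained from F by X_j = 1, and         *)
(* different rows are related by the quotient rule for                        *)
(* X_i / X_l = (X_i / X_j) / (X_l / X_j).  If G j = 0 then phi misses the     *)
(* chart X_j = 1 and row j carries no information; it is set to 0.            *)
Definition rational_field (V : 'M[coneField k]_n) : Prop :=
  [/\ forall j, G j = 0 -> row j V = 0,
      forall j, G j != 0 ->
        V j j = 0 /\ \sum_(i < n) partial_at j i * V j i = 0
    & forall j l i, G j != 0 -> G l != 0 ->
        V l i = (V j i * ratio_coord j l - ratio_coord j i * V j l)
                / ratio_coord j l ^+ 2].

(* The stalk at p of phi^* T_X: the rational sections that are regular at p,  *)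
(* as seen in the affine charts of X containing phi(p).                       *)
Definition pullback_tangent_stalk (p : 'I_2 -> k) (V : 'M[coneField k]_n) : Prop :=
  rational_field V /\
  forall j, (G j).@[p] != 0 -> forall i, O_stalk 0 p (V j i).

(* There is an isomorphism of sheaves on P^1                                  *)
(*   O(a_0) (+) ... (+) O(a_(r-1)) -> phi^* T_X.                              *)
(* Both sides are subsheaves of constant sheaves, so a morphism is given by   *)
(* the images Theta i of the standard generators at the generic point, and it *)
(* is an isomorphism iff it maps stalks bijectively to stalks at all closed   *)
(* points.                                                                    *)
Definition tangent_splitting (r : nat) (a : 'I_r -> int) : Prop :=
  exists Theta : 'I_r -> 'M[coneField k]_n,
  forall p : 'I_2 -> k, P1_point p ->
    (forall c, sumO_stalk a p c ->
       pullback_tangent_stalk p (\sum_(i < r) c ord0 i *: Theta i)) /\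
    (forall V, pullback_tangent_stalk p V ->
       exists! c, sumO_stalk a p c /\ V = \sum_(i < r) c ord0 i *: Theta i).

(* X has dimension n - 2, which is the rank of T_X when X is smooth. *)
Definition free_curve : Prop :=
  exists a : 'I_n.-2 -> int, tangent_splitting a /\ forall i, 0 <= a i.

Definition very_free_curve : Prop :=
  exists a : 'I_n.-2 -> int, tangent_splitting a /\ forall i, 0 < a i.

End RationalCurves.

Definition fermat_quintic (k : closedFieldType) : {mpoly k[6]} :=
  \sum_(i < 6) 'X_i ^+ 5.

(* Main.v *)
(* Let E be the kernel of (G_i^4) : O(d)^6 -> O(5d).  The Euler sequence gives *)
(* T := phi^* T_X = E / O, where O -> E is G itself.  Since 4 is a power of the *)
(* characteristic, E is a Frobenius pullback: the sections of E are built from  *)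
(* fourth powers of syzygies of G, so that E is a sum of line bundles           *)
(* O(d - 4 b_j) with sum b_j = d.  Comparing the dimensions of H^0(T(-1)) and   *)
(* H^0(T(-2)) with the number of syzygies that linear algebra forces rules out  *)
(* free curves of degree < 8 and very free curves of degree 8.                  *)
(*                                                                              *)
(* For existence, explicit curves over F_2 have b = (1,1,2,2,2) in degree 8 and *)
(* b = (1,2,2,2,2) in degree 9.  A frame of T with the right degrees is         *)
(* recognized by the nonvanishing of one determinant at one point: the quotient *)
(* of that determinant by G_j^4 is a regular section of O(d - sum a_l) = O.     *)

(* A field along phi lifts to a vector [A] over the function field with sum A_i G_i^4 = 0, unique up
   to multiples of G; [field_of] and [lift_at] are the two directions. T has degree d, which appears
   here as a determinant: a frame with twists a_l has sum a_l <= d ([frame_det_form]), and equality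
   yields a splitting ([frame_splitting]).

   Lower bounds. If all a_l >= 0 then h^0(T(-1)) = sum a_l <= d. For m > 0, vectors of forms of
   degree d - m killed by (G_i^4) inject into H^0(T(-m)), because O(-m) has no sections
   ([section_bound]). In an affine coordinate x the polynomial G_i^4 is [twist i] evaluated at x^4,
   so a syzygy of degree q of the twists gives s + 1 independent such vectors of degree 4q + s when
   s < 4; linear algebra provides 5q + 5 - d syzygies. Thus d = 4q + s + 1 implies (s + 1)(5q + 5 -
   d) <= d, which is false for d = 1, 2, 3, 6, 7. For d = 4 and d = 5 there is equality, and extra
   syzygies, found through the coefficients of G itself, break it. For d = 8 the same count in T(-2)
   gives 6 sections against a bound of 4.

   Existence. If G = sum c H^4 with every H a syzygy of G, then sum G_i^5 = sum c (sum G_i H_i)^4 =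
   0. The curves are written in this form, and the remaining conditions reduce to counting monomials
   modulo 2. *)
From HB Require Import structures.
Require Import Defs.
From mathcomp Require Import all_boot all_order all_algebra.
From mathcomp Require Import mpoly ring zify.

Set Implicit Arguments.
Unset Strict Implicit.
Unset Printing Implicit Defensive.

Import Order.TTheory GRing.Theory Num.Theory.
Local Open Scope ring_scope.

(** * Binary forms and their dehomogenization *)

Section BinaryForms.
Variable k : closedFieldType.
Implicit Types (P Q : {mpoly k[2]}) (u v : {poly k}) (p : 'I_2 -> k).

Local Notation s := ('X_ord0 : {mpoly k[2]}).
Local Notation t := ('X_ord_max : {mpoly k[2]}).

Definition homogenize m u : {mpoly k[2]} :=
  \sum_(i < m.+1) u`_i *: (s ^+ i * t ^+ (m - i)).

Definition dehomogenize P : {poly k} :=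
  mmap (@polyC k) (fun i : 'I_2 => if i == ord0 then 'X else 1) P.

HB.instance Definition _ := GRing.RMorphism.copy dehomogenize
  (mmap (@polyC k) (fun i : 'I_2 => if i == ord0 then 'X else 1)).

Lemma dehomogenizeZ c P : dehomogenize (c *: P) = c *: dehomogenize P.
Proof. by rewrite /dehomogenize mmapZ mul_polyC. Qed.

Lemma dehomogenize_sum (I : Type) (r : seq I) (F : I -> {mpoly k[2]}) :
  dehomogenize (\sum_(i <- r) F i) = \sum_(i <- r) dehomogenize (F i).
Proof. exact: rmorph_sum. Qed.

Lemma dhomog_var i : ('X_i : {mpoly k[2]}) \is 1.-homog.
Proof. by rewrite dhomogX /= mdeg1. Qed.

Lemma dhomog_monomial a b : s ^+ a * t ^+ b \is (a + b).-homog.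
Proof.
by apply: dhomogM; rewrite -[X in X.-homog]mul1n; apply/dhomogMn/dhomog_var.
Qed.

Lemma homogenize_homog m u : homogenize m u \is m.-homog.
Proof.
apply: rpred_sum => i _; apply: rpredZ.
by have := dhomog_monomial i (m - i); rewrite subnKC // -ltnS.
Qed.

Lemma dehomogenize_var i :
  dehomogenize 'X_i = if i == ord0 then 'X else 1.
Proof. by rewrite /dehomogenize mmapX mmap1U. Qed.

Lemma homogenizeK m u : (size u <= m.+1)%N -> dehomogenize (homogenize m u) = u.
Proof.
move=> um; rewrite dehomogenize_sum.
under eq_bigr => i _ do
  rewrite dehomogenizeZ rmorphM !rmorphXn /= !dehomogenize_var /= expr1n mulr1.
rewrite -[RHS]coefK poly_def (big_ord_widen _ (fun i => u`_i *: 'X^i) um) [RHS]big_mkcond /=.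
by apply: eq_bigr => i _; case: ltnP => // h; rewrite nth_default // scale0r.
Qed.

Lemma dehomogenizeX (m : 'X_{1..2}) : dehomogenize 'X_[m] = 'X^(m ord0).
Proof.
rewrite /dehomogenize mmapX /mmap1 big_ord_recl big_ord1 /= expr1n mulr1 //.
Qed.

Lemma mpolyX2 (m : 'X_{1..2}) : 'X_[m] = s ^+ m ord0 * t ^+ m ord_max.
Proof.
rewrite mpolyXE_id big_ord_recl big_ord1; congr (_ ^+ _ * 'X_ _ ^+ m _); exact: val_inj.
Qed.

Lemma dehomogenizeK m P : P \is m.-homog -> homogenize m (dehomogenize P) = P.
Proof.
move=> /dhomogP hP.
rewrite [in LHS](mpolyE P) [RHS](mpolyE P) dehomogenize_sum /homogenize.
under eq_bigr => i _ do rewrite coef_sum scaler_suml.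
rewrite exchange_big /= big_seq [RHS]big_seq; apply: eq_bigr => e /hP /= he.
have e2 : (e ord0 + e ord_max)%N = m.
  by rewrite -he mdegE big_ord_recl big_ord1; congr (_ + e _)%N; apply: val_inj.
have lt_e : (e ord0 < m.+1)%N by lia.
under eq_bigr => i _ do
  rewrite -/(dehomogenize _) dehomogenizeZ dehomogenizeX coefZ coefXn.
rewrite (bigD1 (Ordinal lt_e)) //= eqxx mulr1 big1 ?addr0.
  by rewrite [in RHS]mpolyX2 /= -[in (m - _)%N]e2 addKn.
move=> i /negbTE hi; case: eqP => [E|]; last by rewrite mulr0 scale0r.
by move: hi; rewrite -(inj_eq val_inj) /= E eqxx.
Qed.

Lemma size_dehomogenize m P : P \is m.-homog -> (size (dehomogenize P) <= m.+1)%N.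
Proof.
move=> hP; have := dehomogenizeK hP => {1}<-.
rewrite dehomogenize_sum; apply: (leq_trans (size_sum _ _ _)).
apply/bigmax_leqP => i _; rewrite dehomogenizeZ rmorphM !rmorphXn /=.
rewrite !dehomogenize_var /= expr1n mulr1.
by apply: (leq_trans (size_scale_leq _ _)); rewrite size_polyXn.
Qed.

Lemma dehomogenize_inj m P Q : P \is m.-homog -> Q \is m.-homog ->
  dehomogenize P = dehomogenize Q -> P = Q.
Proof. by move=> hP hQ E; rewrite -(dehomogenizeK hP) E dehomogenizeK. Qed.

Lemma homogenizeM m n u v : (size u <= m.+1)%N -> (size v <= n.+1)%N ->
  homogenize (m + n) (u * v) = homogenize m u * homogenize n v.
Proof.
move=> hu hv; apply: (@dehomogenize_inj (m + n)).
- exact: homogenize_homog.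
- by apply: dhomogM; apply: homogenize_homog.
- rewrite rmorphM /= !homogenizeK //.
  by apply: (leq_trans (size_polyMleq _ _)); lia.
Qed.

Lemma homogenize0 m : homogenize m 0 = 0.
Proof. by rewrite /homogenize big1 // => i _; rewrite coef0 scale0r. Qed.

Lemma meval_homogenize m u p :
  (homogenize m u).@[p] = \sum_(i < m.+1) u`_i * (p ord0 ^+ i * p ord_max ^+ (m - i)).
Proof.
rewrite /homogenize raddf_sum /=; apply: eq_bigr => i _.
by rewrite mevalZ mevalM !rmorphXn /= !mevalXU.
Qed.

Definition line_at p : {mpoly k[2]} := p ord_max *: s - p ord0 *: t.

Lemma meval_line_at p : (line_at p).@[p] = 0.
Proof. by rewrite mevalB !mevalZ !mevalXU mulrC subrr. Qed.

(** Where t is nonzero this is the factor theorem for the dehomogenization. At [1 : 0] vanishing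
    means that the coefficient of s^m is zero, so t divides [P]. For m = 0 the form is a constant
    and hence zero. *)
Lemma line_at_dvd m P p : P1_point p -> P \is m.-homog -> P.@[p] = 0 ->
  exists Q, P = line_at p * Q /\ Q \is m.-1.-homog.
Proof.
move=> hp hP P0; case: m hP => [|m] hP.
  exists 0; split; last exact: dhomog0.
  move: P0; rewrite -(dehomogenizeK hP) meval_homogenize big_ord1 /homogenize big_ord1 /=.
  by rewrite !mulr1 => ->; rewrite scale0r mulr0.
have := size_dehomogenize hP; have := dehomogenizeK hP.
set u := dehomogenize P => uP su.
have [p1|p1] := eqVneq (p ord_max) 0.
  have p0 : p ord0 != 0.
    case: hp => i; case: (unliftP ord_max i) => [j|] ->; last by rewrite p1 eqxx.
    by congr (p _ != 0); apply: val_inj; case: j => [[]].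
  have um : u`_m.+1 = 0.
    move: P0; rewrite -uP meval_homogenize big_ord_recr big1 /= ?add0r.
      rewrite subnn mulr1 => /eqP; rewrite mulf_eq0 => /orP[/eqP //|].
      by rewrite expf_eq0 (negbTE p0) andbF.
    move=> i _; rewrite p1 expr0n subn_eq0 leqNgt ltn_ord /=.
    by rewrite !mulr0.
  have su' : (size u <= m.+1)%N.
    apply/leq_sizeP => j; rewrite leq_eqVlt => /orP[/eqP<- //|hj].
    by apply: nth_default; apply: leq_trans hj.
  exists (- (p ord0)^-1 *: homogenize m u); split; last first.
    by apply: rpredZ; apply: homogenize_homog.
  rewrite /line_at p1 scale0r sub0r -scalerAr mulNr scaleNr scalerN opprK.
  rewrite -scalerAl scalerA mulVf // scale1r.
  have -> : t = homogenize 1 1.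
    by rewrite /homogenize big_ord_recl big_ord1 /= coef1 coefC /= scale1r scale0r addr0 mul1r.
  by rewrite -homogenizeM ?size_poly1 // mul1r uP.
have ru : root u (p ord0 / p ord_max).
  apply/rootP; rewrite (horner_coef_wide _ su).
  apply: (mulIf (expf_neq0 m.+1 p1)); rewrite mul0r -[RHS]P0 -uP meval_homogenize mulr_suml.
  apply: eq_bigr => i _; rewrite expr_div_n -!mulrA; congr (_ * (_ * _)).
  move: (i : nat) (ltn_ord i) => {}i; rewrite ltnS => le_i.
  by rewrite -[in LHS](subnKC le_i) exprD mulKf // expf_neq0.
have /factor_theorem [v uv] := ru.
exists ((p ord_max)^-1 *: homogenize m v); split; last first.
  by apply: rpredZ; apply: homogenize_homog.
have sv : (size v <= m.+1)%N.
  have [->|v0] := eqVneq v 0; first by rewrite size_poly0.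
  by move: su; rewrite uv size_Mmonic ?monicXsubC // size_XsubC addn2.
rewrite -scalerAr scalerAl -uP uv mulrC (@homogenizeM 1 m) ?size_XsubC //.
congr (_ * _); rewrite /line_at scalerBr !scalerA mulVf // scale1r mulrC.
by rewrite /homogenize big_ord_recl big_ord1 /= !coefB !coefX !coefC /= !sub0r subr0
  scale1r expr0 expr1 mul1r mulr1 addrC scaleNr.
Qed.

End BinaryForms.

(** * Stalks and global sections of O(a) *)

Section Stalks.
Variable k : closedFieldType.
Implicit Types (P Q : {mpoly k[2]}) (p : 'I_2 -> k) (f g : coneField k) (a b : int).

(** A dehomogenization of full degree has a root because [k] is algebraically closed; if its degree
    drops, the zero is at infinity, [1 : 0]. *)
Lemma exists_zero n Q : Q \is n.+1.-homog -> Q != 0 ->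
  exists p, P1_point p /\ Q.@[p] = 0.
Proof.
move=> hQ Q0; have := size_dehomogenize hQ; have := dehomogenizeK hQ.
set u := dehomogenize Q => uQ su.
pose pt (c d : k) (i : 'I_2) := if i == ord0 then c else d.
have u0 : u != 0 by apply: contraNneq Q0 => u0; rewrite -uQ u0 homogenize0.
have [lt_u|ge_u] := leqP (size u) n.+1.
  exists (pt 1 0); split; first by exists ord0; apply: oner_neq0.
  rewrite -uQ meval_homogenize big1 // => i _; rewrite /pt /= expr1n mul1r expr0n.
  rewrite subn_eq0; case: leqP => hi; first by rewrite mulr0.
  by rewrite nth_default ?mul0r // (leq_trans lt_u).
have /closed_rootP [c /rootP uc] : size u != 1%N by rewrite neq_ltn (leq_trans _ ge_u) ?orbT.
exists (pt c 1); split; first by exists ord_max; apply: oner_neq0.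
rewrite -uQ meval_homogenize -[RHS]uc (horner_coef_wide _ su).
by apply: eq_bigr => i _; rewrite /pt /= expr1n mulr1.
Qed.

Lemma tofrac_neq0 P p : P.@[p] != 0 -> tofrac P != 0.
Proof. by apply: contraNneq => /eqP; rewrite tofrac_eq0 => /eqP->; rewrite meval0. Qed.

Lemma O_stalk_poly m P p : P \is m.-homog -> O_stalk m%:Z p (tofrac P).
Proof.
move=> hP; exists m, 0%N, P, 1; split=> //; first exact: dhomog1.
- by rewrite subr0.
- by rewrite meval1 oner_neq0.
- by rewrite tofrac1 divr1.
Qed.

Lemma O_stalk_polyV m P p : P \is m.-homog -> P.@[p] != 0 ->
  O_stalk (- m%:Z) p (tofrac P)^-1.
Proof.
move=> hP Pp; exists 0%N, m, 1, P; split=> //; first exact: dhomog1.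
- by rewrite sub0r.
- by rewrite tofrac1 div1r.
Qed.

Lemma O_stalkM a b p f g : O_stalk a p f -> O_stalk b p g -> O_stalk (a + b) p (f * g).
Proof.
case=> m [n] [P] [Q] [hP hQ <- Q0 ->]; case=> m' [n'] [P'] [Q'] [hP' hQ' <- Q0' ->].
exists (m + m')%N, (n + n')%N, (P * P'), (Q * Q'); split; try exact: dhomogM.
- by rewrite !PoszD; ring.
- by rewrite mevalM mulf_neq0.
- by rewrite !tofracM mulf_div.
Qed.

Lemma O_stalkD a p f g : O_stalk a p f -> O_stalk a p g -> O_stalk a p (f + g).
Proof.
case=> m [n] [P] [Q] [hP hQ <- Q0 ->]; case=> m' [n'] [P'] [Q'] [hP' hQ' E Q0' ->].
exists (m + n')%N, (n + n')%N, (P * Q' + P' * Q), (Q * Q'); split.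
- apply: rpredD; first exact: dhomogM.
  have -> : (m + n' = m' + n)%N by lia.
  exact: dhomogM.
- exact: dhomogM.
- by rewrite !PoszD; ring.
- by rewrite mevalM mulf_neq0.
- by rewrite tofracD !tofracM (addf_div _ _ (tofrac_neq0 Q0) (tofrac_neq0 Q0')).
Qed.

Lemma O_stalkN a p f : O_stalk a p f -> O_stalk a p (- f).
Proof.
case=> m [n] [P] [Q] [hP hQ E Q0 ->]; exists m, n, (- P), Q; split=> //.
  by rewrite rpredN.
by rewrite tofracN mulNr.
Qed.

Lemma O_stalkB a p f g : O_stalk a p f -> O_stalk a p g -> O_stalk a p (f - g).
Proof. by move=> hf hg; apply: O_stalkD => //; apply: O_stalkN. Qed.

Lemma O_stalk1 p : O_stalk 0 p (1 : coneField k).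
Proof. by rewrite -tofrac1; apply: (@O_stalk_poly 0); apply: dhomog1. Qed.

Lemma O_stalkX a p f n : O_stalk a p f -> O_stalk (a *+ n) p (f ^+ n).
Proof.
move=> hf; elim: n => [|n IHn]; first by rewrite mulr0n expr0; apply: O_stalk1.
by rewrite mulrS exprS; apply: O_stalkM.
Qed.

(** A power of a coordinate that is nonzero at [p] trivializes O(a) there, which allows twists to be
    removed and restored stalkwise. *)
Lemma O_stalk_unit p a : P1_point p ->
  exists u : coneField k, [/\ u != 0, O_stalk a p u & O_stalk (- a) p u^-1].
Proof.
case=> i pi0; pose P : {mpoly k[2]} := 'X_i ^+ `|a|%N.
have hP : P \is (`|a|%N).-homog by rewrite -[X in X.-homog]mul1n; apply/dhomogMn/dhomog_var.
have Pp : P.@[p] != 0 by rewrite rmorphXn /= mevalXU expf_neq0.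
have P0 := tofrac_neq0 Pp.
case: (lerP 0 a) => [a0|/ltW a0].
  exists (tofrac P); split=> //.
    by rewrite -[X in O_stalk X](gez0_abs a0); apply: O_stalk_poly.
  by rewrite -[X in O_stalk (- X)](gez0_abs a0); apply: O_stalk_polyV.
exists (tofrac P)^-1; split; first by rewrite invr_eq0.
  by rewrite -[a]opprK -(lez0_abs a0); apply: O_stalk_polyV.
by rewrite invrK -(lez0_abs a0); apply: O_stalk_poly.
Qed.

Lemma O_stalk0 a p : P1_point p -> O_stalk a p (0 : coneField k).
Proof.
move=> /(O_stalk_unit a) [u [_ hu _]].
by rewrite -(subrr u); apply: O_stalkB.
Qed.

Lemma O_stalk_sum (I : finType) (D : pred I) a p (F : I -> coneField k) : P1_point p ->
  (forall i, D i -> O_stalk a p (F i)) -> O_stalk a p (\sum_(i | D i) F i).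
Proof.
move=> hp hF; elim/big_ind: _ => //; first exact: O_stalk0.
by move=> x y; apply: O_stalkD.
Qed.

Lemma O_stalk_prod (I : finType) (a : I -> int) p (F : I -> coneField k) :
  (forall i, O_stalk (a i) p (F i)) -> O_stalk (\sum_i a i) p (\prod_i F i).
Proof.
move=> hF; elim/big_ind2: _ => //; first exact: O_stalk1.
by move=> x1 x2 y1 y2; apply: O_stalkM.
Qed.

Lemma O_stalk_det n (w : 'I_n -> int) p (N : 'M[coneField k]_n) : P1_point p ->
  (forall i j, O_stalk (w i) p (N i j)) -> O_stalk (\sum_i w i) p (\det N).
Proof.
move=> hp hN; apply: O_stalk_sum => // s _.
rewrite -[\sum_i _]add0r; apply: O_stalkM; last exact: O_stalk_prod.
by case: (perm.odd_perm s); rewrite ?expr1 ?expr0; [apply: O_stalkN|]; apply: O_stalk1.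
Qed.

Lemma O_stalk_cofactor n (w : 'I_n -> int) p (N : 'M[coneField k]_n) i j : P1_point p ->
  (forall i j, O_stalk (w i) p (N i j)) ->
  O_stalk (\sum_i w i - w i) p (cofactor N i j).
Proof.
case: n w N i j => [|n] w N i j hp hN; first by case: i.
rewrite /cofactor -[X in O_stalk X]add0r; apply: O_stalkM.
  rewrite -[0](mul0rn _ (i + j)%N); apply: O_stalkX.
  by apply: O_stalkN; apply: O_stalk1.
have -> : \sum_i w i - w i = \sum_j w (lift i j) by rewrite (bigD1_ord i) //= addrAC subrr add0r.
apply: O_stalk_det => // i' j'.
by rewrite !mxE.
Qed.

Lemma dhomog_const P : P \is 0.-homog -> P = (P@_0)%:MP.
Proof.
move=> hP; apply: msize1_polyC; have [->|P0] := eqVneq P 0; first by rewrite msize0.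
by rewrite -(mlead_deg P0) (dhomogP _ _ _ hP) ?mlead_supp.
Qed.

(* A global section of O(a) is a form of degree a: at a zero of the           *)
(* denominator, a representation valid there shows that the numerator vanishes *)
(* too, so a linear form cancels.                                             *)
Lemma global_section a f : (forall p, P1_point p -> O_stalk a p f) -> f != 0 ->
  exists m P, [/\ m%:Z = a, P \is m.-homog & f = tofrac P].
Proof.
move=> hf f0.
pose pt (i : 'I_2) : k := 1.
have /hf [m [n [P [Q [hP hQ E Q0 fE]]]]] : P1_point pt by exists ord0; apply: oner_neq0.
have {Q0} Q0 : Q != 0 by apply: contraNneq Q0 => ->; rewrite meval0.
elim: n m P Q hP hQ E Q0 fE => [|n IHn] m P Q hP hQ E Q0 fE.
  have QE := dhomog_const hQ.
  have Qc : Q@_0 != 0 by apply: contraNneq Q0 => Q00; rewrite QE Q00 mpolyC0.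
  exists m, ((Q@_0)^-1 *: P); split; first by rewrite -E subr0.
    exact: rpredZ.
  by rewrite fE QE -mul_mpolyC tofracM -[in RHS]mulrC; congr (_ * _);
    rewrite mpolyCK; apply: (mulIf (x := tofrac (Q@_0)%:MP));
    rewrite ?tofrac_eq0 ?mpolyC_eq0 // mulVf ?tofrac_eq0 ?mpolyC_eq0 //;
    rewrite -tofracM -mpolyCM mulVf // tofrac1.
have [p [hp Qp]] := exists_zero hQ Q0.
have [m' [n' [P' [Q' [hP' hQ' E' Q0' fE']]]]] := hf p hp.
have PQ : P * Q' = P' * Q.
  apply/eqP; rewrite -tofrac_eq !tofracM -eqr_div ?tofrac_eq0 //; first by rewrite -fE -fE'.
  by rewrite -tofrac_eq0 (tofrac_neq0 Q0').
have Pp : P.@[p] = 0.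
  apply/eqP; have := congr1 (meval p) PQ; rewrite !mevalM Qp mulr0 => /eqP.
  by rewrite mulf_eq0 (negbTE Q0') orbF.
have [P1 [P1E hP1]] := line_at_dvd hp hP Pp.
have [Q1 [Q1E hQ1]] := line_at_dvd hp hQ Qp.
have l0 : tofrac (line_at p) != 0.
  by move: Q0; rewrite tofrac_eq0 Q1E mulf_eq0 negb_or => /andP[].
have P0 : P != 0 by apply: contraNneq f0 => P0; rewrite fE P0 tofrac0 mul0r.
have m0 : (0 < m)%N.
  case: m {E} hP {hP1} => // hP; case/negP: P0; move: hP => hP0.
  have PE := dhomog_const hP0.
  by move: Pp; rewrite [X in meval _ X]PE mevalC => c0; rewrite PE c0 mpolyC0.
apply: (IHn m.-1 P1 Q1) => //.
- by move: E m0; clear; lia.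
- by move: Q0; rewrite Q1E mulf_eq0 negb_or => /andP[].
- by rewrite fE P1E Q1E !tofracM invfM mulrACA divff // mul1r.
Qed.

Lemma global_section_neg a f : (forall p, P1_point p -> O_stalk a p f) -> a < 0 -> f = 0.
Proof.
move=> hf a0; apply/eqP/negPn/negP => /(global_section hf) [m [_ [ma _ _]]].
by move: a0; rewrite -ma.
Qed.

End Stalks.

(** * Fields along the curve and splittings of the tangent bundle *)

Section QuotientRule.
Variable F : fieldType.
Implicit Types a b c x y z : F.

Lemma weighted_quotient a b y z : z != 0 ->
  (y / z) ^+ 4 * ((a * z - y * b) / z ^+ 2) = (a * y ^+ 4 * z - y * y ^+ 4 * b) / z ^+ 6.
Proof. by move=> z0; field. Qed.

Lemma quotient_rule a b c x y z : y != 0 -> z != 0 ->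
  (a * z - x * c) / z ^+ 2 =
  ((a * y - x * b) / y ^+ 2 * (z / y) - x / y * ((c * y - z * b) / y ^+ 2)) / (z / y) ^+ 2.
Proof. by move=> y0 z0; field; rewrite y0 z0. Qed.

Lemma weighted_lift a y z : z != 0 -> z * a * y ^+ 4 = z ^+ 5 * ((y / z) ^+ 4 * a).
Proof. by move=> z0; field. Qed.

Lemma quotient_rule_lift a b x y z : y != 0 -> z != 0 ->
  (y * a * z - x * (y * b)) / z ^+ 2 = (a * (z / y) - x / y * b) / (z / y) ^+ 2.
Proof. by move=> y0 z0; field; rewrite y0 z0. Qed.

Lemma wedge_linear a b c x y z : c * ((a * y - x * b) / z) = (c * a * y - x * (c * b)) / z.
Proof. by rewrite mulrA; congr (_ / _); ring. Qed.

Lemma wedge_shift a b c x y : (a + c * x) * y - x * (b + c * y) = a * y - x * b.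
Proof. by ring. Qed.

Lemma wedge_add a a' b b' x y z :
  ((a + a') * y - x * (b + b')) / z = (a * y - x * b) / z + (a' * y - x * b') / z.
Proof. by ring. Qed.

Lemma wedge_sub a a' b b' x y z :
  ((a - a') * y - x * (b - b')) / z = (a * y - x * b) / z - (a' * y - x * b') / z.
Proof. by ring. Qed.

Lemma fourth_power_quotient x y : y != 0 ->
  x ^+ 4 - (x / y) ^+ 4 * y ^+ 4 = 0.
Proof. by move=> y0; field. Qed.

End QuotientRule.

(* Unification must not compute in the field of fractions. *)
Local Opaque determinant FracField.tofrac FracField.mul FracField.add FracField.inv FracField.opp.

Lemma weight_split (d : nat) (x : int) :
  x = d%:Z + (- (d * 4)%N%:Z + ((d * 5)%N%:Z - d%:Z - (d%:Z - x))).
Proof. by lia. Qed.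

Section Tangent.
Variable k : closedFieldType.
Hypothesis hk : 2%N \in [pchar k].
Variables (d : nat) (G : 'I_6 -> {mpoly k[2]}).
Hypothesis G_homog : forall i, G i \is d.-homog.
Hypothesis G_fermat : \sum_i G i ^+ 5 = 0.
Hypothesis G_nonzero : forall p, P1_point p -> exists j, (G j).@[p] != 0.

Local Notation K := (coneField k).
Local Notation g i := (tofrac (G i)).
Implicit Types (p : 'I_2 -> k) (A : 'rV[K]_6) (Y : 'M[K]_(4, 6)).

Definition gvec : 'rV[K]_6 := \row_i g i.
Definition gpow4 : 'cV[K]_6 := \col_i g i ^+ 4.

Lemma gvec_gpow4 : gvec *m gpow4 = 0.
Proof.
apply/matrixP => i j; rewrite !mxE; under eq_bigr => l _ do rewrite !mxE -exprS -tofracXn.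
by rewrite -rmorph_sum /= G_fermat tofrac0.
Qed.

(** The factor 5 of the derivative is 1 in characteristic 2, so the gradient of the Fermat quintic
    consists of fourth powers. *)
Lemma partial_at_fermat j i :
  partial_at (fermat_quintic k) G j i = ratio_coord G j i ^+ 4.
Proof.
rewrite /partial_at; have -> : (fermat_quintic k)^`M(i) = 'X_i ^+ 4.
  rewrite /fermat_quintic raddf_sum /= (bigD1 i) //= big1 => [|l li].
    rewrite !mpolyXn mderivX mulmnE mnm1E eqxx mul1n addr0.
    have -> : (U_(i) *+ 5 - U_(i) = U_(i) *+ 4 :> 'X_{1..6})%MM.
      by apply/mnmP => l; rewrite mnmBE !mulmnE; case: (U_(i)%MM l) => // m; lia.
    have -> : 5%:R = 1 :> k by rewrite (natrD _ 4 1) (natrM _ 2 2) (pcharf0 hk) mul0r add0r.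
    by rewrite scale1r.
  by rewrite mpolyXn mderivX mulmnE mnm1E (negbTE li) mul0n scale0r.
have -> : (fun c : k => tofrac c%:MP_[2]) = @tofrac _ \o @mpolyC 2 k by [].
by rewrite rmorphXn /= mmapX mmap1U.
Qed.

(** [A] prescribes the derivatives of the homogeneous coordinates X_i; the entries are the resulting
    derivatives of X_i / X_j by the quotient rule. *)
Definition field_of A : 'M[K]_6 :=
  \matrix_(j, i) if G j == 0 then 0 else (A 0 i * g j - g i * A 0 j) / g j ^+ 2.

Lemma field_of_rational A : A *m gpow4 = 0 ->
  rational_field (fermat_quintic k) G (field_of A).
Proof.
move=> Aq; split=> [j Gj|j Gj|j l i Gj Gl].
- by apply/rowP => i; rewrite !mxE Gj eqxx.
- split; first by rewrite mxE (negbTE Gj) [g j * _]mulrC subrr mul0r.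
  have gj : g j != 0 by rewrite tofrac_eq0.
  have -> : \sum_i partial_at (fermat_quintic k) G j i * field_of A j i =
      ((A *m gpow4) 0 0 * g j - (gvec *m gpow4) 0 0 * A 0 j) / g j ^+ 6.
    rewrite !mxE !mulr_suml -sumrB mulr_suml; apply: eq_bigr => i _.
    by rewrite partial_at_fermat !mxE (negbTE Gj) weighted_quotient.
  by rewrite Aq gvec_gpow4 !mxE !mul0r subr0 mul0r.
- have gj : g j != 0 by rewrite tofrac_eq0.
  have gl : g l != 0 by rewrite tofrac_eq0.
  rewrite !mxE (negbTE Gj) (negbTE Gl) /ratio_coord.
  exact: (quotient_rule (A 0 i) (A 0 j) (A 0 l) (g i) gj gl).
Qed.

(** The lift along which X_j is constant; it is regular at points where G_j is nonzero. *)
Definition lift_at j (V : 'M[K]_6) : 'rV[K]_6 := g j *: row j V.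

Lemma lift_at_gpow4 j V : G j != 0 -> rational_field (fermat_quintic k) G V ->
  lift_at j V *m gpow4 = 0.
Proof.
move=> Gj [_ /(_ j Gj) [_ Vj] _]; apply/matrixP => a b; rewrite (ord1 a) (ord1 b) mxE [RHS]mxE {a b}.
have gj : g j != 0 by rewrite tofrac_eq0.
have -> : \sum_i lift_at j V 0 i * gpow4 i 0 =
   g j ^+ 5 * \sum_i partial_at (fermat_quintic k) G j i * V j i.
  rewrite mulr_sumr; apply: eq_bigr => i _.
  by rewrite partial_at_fermat !mxE weighted_lift.
by rewrite Vj mulr0.
Qed.

Lemma lift_atK j V : G j != 0 -> rational_field (fermat_quintic k) G V ->
  field_of (lift_at j V) = V.
Proof.
move=> Gj [V0 Vd VV]; apply/matrixP => l i; rewrite !mxE.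
have gj : g j != 0 by rewrite tofrac_eq0.
case: eqVneq => [Gl|Gl].
  by have /rowP/(_ i) := V0 _ Gl; rewrite !mxE.
have gl : g l != 0 by rewrite tofrac_eq0.
rewrite (VV j l i) // /ratio_coord.
exact: (quotient_rule_lift (V j i) (V j l) (g i) gj gl).
Qed.

Lemma field_of_stalk p A : P1_point p -> A *m gpow4 = 0 ->
  (forall i, O_stalk d p (A 0 i)) ->
  pullback_tangent_stalk (fermat_quintic k) G p (field_of A).
Proof.
move=> hp Aq hA; split; first exact: field_of_rational.
move=> j Gjp i; rewrite mxE.
have -> : (G j == 0) = false by rewrite -tofrac_eq0; apply/negbTE/(tofrac_neq0 Gjp).
have <- : (d%:Z + d%:Z) + - (d * 2)%N%:Z = 0%R :> int by lia.
apply: O_stalkM.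
  by apply: O_stalkB; apply: O_stalkM => //; apply: O_stalk_poly.
rewrite -tofracXn; apply: O_stalk_polyV; first exact: dhomogMn.
by rewrite rmorphXn /= expf_neq0.
Qed.

Lemma lift_at_stalk p j V : (G j).@[p] != 0 ->
  pullback_tangent_stalk (fermat_quintic k) G p V ->
  forall i, O_stalk d p (lift_at j V 0 i).
Proof.
move=> Gjp [_ /(_ j Gjp) hV] i; rewrite !mxE -[X in O_stalk X]addr0.
by apply: O_stalkM => //; apply: O_stalk_poly.
Qed.

Lemma field_of_mul r (c : 'rV[K]_r) (Y : 'M[K]_(r, 6)) :
  field_of (c *m Y) = \sum_i c 0 i *: field_of (row i Y).
Proof.
apply/matrixP => j i; rewrite summxE !mxE; under [RHS]eq_bigr => l _ do rewrite !mxE.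
case: ifP => _; first by rewrite big1 // => l _; rewrite mulr0.
rewrite mulr_suml mulr_sumr -sumrB mulr_suml; apply: eq_bigr => l _.
by rewrite wedge_linear !mulrA.
Qed.

Lemma field_of_shift A (x : K) : field_of (A + x *: gvec) = field_of A.
Proof.
apply/matrixP => j i; rewrite !mxE; case: eqVneq => // Gj.
by rewrite wedge_shift.
Qed.

(** Exactness of the Euler sequence at the generic point. *)
Lemma field_of_eq0 A j : G j != 0 -> field_of A = 0 -> A = (A 0 j / g j) *: gvec.
Proof.
move=> Gj /matrixP/(_ j) h; apply/rowP => i; move: (h i).
have gj : g j != 0 by rewrite tofrac_eq0.
rewrite !mxE (negbTE Gj) => /eqP; rewrite mulf_eq0 invr_eq0 expf_eq0 /= (negbTE gj) orbF.
by rewrite subr_eq0 => /eqP E; rewrite mulrAC; apply/(canRL (mulfK gj)); rewrite E mulrC.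
Qed.

Lemma field_ofD A B : field_of (A + B) = field_of A + field_of B.
Proof.
apply/matrixP => j i; rewrite !mxE; case: ifP => _; first by rewrite addr0.
exact: wedge_add.
Qed.

Lemma field_of0 : field_of 0 = 0.
Proof. by apply/matrixP => j i; rewrite !mxE !mul0r mulr0 subr0 mul0r if_same. Qed.

Lemma field_ofB A B : field_of (A - B) = field_of A - field_of B.
Proof.
apply/matrixP => j i; rewrite !mxE; case: ifP => _; first by rewrite subr0.
exact: wedge_sub.
Qed.

(** * Frames of the tangent bundle and their determinants *)

(** Four lifts are completed to a square matrix by G, which spans the kernel of [field_of], and by
    [w], in practice a basis vector transverse to the kernel of (G_i^4). *)
Definition frame Y (w : 'rV[K]_6) : 'M[K]_6 := col_mx Y (col_mx gvec w).

Lemma frame_det_shift Y (x : 'cV[K]_4) w : \det (frame (Y + x *m gvec) w) = \det (frame Y w).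
Proof.
have -> : frame (Y + x *m gvec) w =
    (block_mx 1%:M (row_mx x 0) 0 1%:M : 'M_(4 + (1 + 1))) *m frame Y w.
  rewrite /frame (@mul_block_col _ 4 2 4 2 6) mul1mx mul0mx add0r mul1mx.
  by rewrite (@mul_row_col _ 4 1 1 6) mul0mx addr0.
by rewrite det_mulmx (@det_ublock _ 4 2) !det1 !mul1r.
Qed.

Lemma frame_gpow4 Y w : Y *m gpow4 = 0 ->
  frame Y w *m gpow4 = (col_mx 0 (col_mx 0 (w *m gpow4)) : 'cV_(4 + (1 + 1))).
Proof. by move=> Yq; rewrite /frame (@mul_col_mx _ 4 2) (@mul_col_mx _ 1 1) Yq gvec_gpow4. Qed.

Definition frame_last : 'I_6 := rshift 4 (rshift 1 (ord0 : 'I_1)).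

Lemma frame_lastE Y w i : frame Y w frame_last i = w 0 i.
Proof. by rewrite /frame /frame_last (@col_mxEd _ 4 2) (@col_mxEd _ 1 1). Qed.

Lemma frame_indexP (r : 'I_6) :
  [\/ exists a : 'I_4, r = lshift (1 + 1) a, r = rshift 4 (lshift 1 (ord0 : 'I_1))
    | r = frame_last].
Proof.
case: (split_ordP (r : 'I_(4 + (1 + 1)))) => [a|b] ->; first by constructor 1; exists a.
case: (split_ordP b) => c ->; rewrite (ord1 c); first by constructor 2.
by constructor 3.
Qed.

Lemma frame_row Y w w' r i : r != frame_last -> frame Y w r i = frame Y w' r i.
Proof.
rewrite /frame; case: (frame_indexP r) => [[a ->]|->|->].
- by rewrite !(@col_mxEu _ 4 2).
- by rewrite !(@col_mxEd _ 4 2) !(@col_mxEu _ 1 1).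
- by rewrite eqxx.
Qed.

(** As a vector in j, the determinant is orthogonal to the rows of [Y] and to G, and so is (G_j^4);
    hence the two are proportional. Applying the adjugate to [frame_gpow4] gives this without
    discussing ranks. *)
Lemma frame_det Y j l : Y *m gpow4 = 0 ->
  \det (frame Y (delta_mx 0 j)) * g l ^+ 4 = \det (frame Y (delta_mx 0 l)) * g j ^+ 4.
Proof.
move=> Yq; have := congr1 (mulmx (\adj (frame Y (delta_mx 0 j)))) (frame_gpow4 (delta_mx 0 j) Yq).
rewrite mulmxA mul_adj_mx mul_scalar_mx => /matrixP/(_ l 0).
rewrite [LHS]mxE [gpow4 _ _]mxE [RHS]mxE => ->.
rewrite (bigD1 frame_last) //= big1 ?addr0; last first.
  move=> r hr; case: (frame_indexP r) hr => [[a ->]|->|->] hr.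
  - by rewrite (@col_mxEu _ 4 2) [X in _ * X]mxE mulr0.
  - by rewrite (@col_mxEd _ 4 2) (@col_mxEu _ 1 1) [X in _ * X]mxE mulr0.
  - by rewrite eqxx in hr.
rewrite (@col_mxEd _ 4 2) (@col_mxEd _ 1 1) -rowE 2!mxE [gpow4 _ _]mxE; congr (_ * _).
rewrite (expand_det_row (frame Y (delta_mx 0 l)) frame_last) (bigD1 l) //= big1 ?addr0.
  rewrite frame_lastE mxE !eqxx mul1r /cofactor; congr (_ * \det _).
  by apply/matrixP => a b; do 2!rewrite [LHS]mxE [RHS]mxE; apply: frame_row; rewrite eq_sym neq_lift.
by move=> i /negbTE il; rewrite frame_lastE mxE il andbF mul0r.
Qed.

(* The rows of a local frame span, together with G, the kernel of             *)
(* (G_i^4) : O(d)^6 -> O(5d) near each point.                                 *)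
Definition local_frame (a : 'I_4 -> int) Y := forall p, P1_point p ->
  exists x : 'cV[K]_4, forall l i, O_stalk (d%:Z - a l) p ((Y + x *m gvec) l i).

Definition weight (a : 'I_4 -> int) (r : 'I_6) : int :=
  (col_mx (\col_l (d%:Z - a l)) (col_mx (const_mx d%:Z) 0) : 'cV_(4 + (1 + 1))) r 0.

Lemma sum_weight a : \sum_r weight a r = (d * 5)%N%:Z - \sum_l a l.
Proof.
rewrite /weight (@big_split_ord _ _ _ 4 2) /= (@big_split_ord _ _ _ 1 1) /= !big_ord1.
under eq_bigr => l _ do rewrite (@col_mxEu _ 4 2) mxE.
rewrite !(@col_mxEd _ 4 2) (@col_mxEu _ 1 1) (@col_mxEd _ 1 1) !mxE addr0 big_split /= sumrN sumr_const card_ord.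
by rewrite PoszM; ring.
Qed.

Lemma frame_stalk a p Y j : P1_point p ->
  (forall l i, O_stalk (d%:Z - a l) p (Y l i)) ->
  forall r i, O_stalk (weight a r) p (frame Y (delta_mx 0 j) r i).
Proof.
move=> hp hY r i; rewrite /weight /frame; case: (frame_indexP r) => [[l ->]|->|->].
- by rewrite !(@col_mxEu _ 4 2) mxE.
- by rewrite !(@col_mxEd _ 4 2) !(@col_mxEu _ 1 1) !mxE; apply: O_stalk_poly.
- rewrite !(@col_mxEd _ 4 2) !(@col_mxEd _ 1 1) !mxE; case: (_ && _); [exact: O_stalk1|exact: O_stalk0].
Qed.

Lemma frame_det_stalk a p Y j : P1_point p -> local_frame a Y ->
  O_stalk ((d * 5)%N%:Z - \sum_l a l) p (\det (frame Y (delta_mx 0 j))).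
Proof.
move=> hp /(_ p hp) [x hx]; rewrite -(frame_det_shift _ x) -sum_weight.
by apply: O_stalk_det => //; apply: frame_stalk.
Qed.

Lemma exists_nonzero_coord : exists j, G j != 0.
Proof.
have [j hj] : exists j, (G j).@[fun=> 1] != 0.
  by apply: G_nonzero; exists ord0; apply: oner_neq0.
by exists j; apply: contraNneq hj => ->; rewrite meval0.
Qed.

(** By [frame_det] the quotient of the determinant by g_j^4 does not depend on j, so at each point a
    j with G_j nonzero there shows that it is regular. Its degree is (5d - sum a_l) - 4d; it is the
    determinant of the map from the sum of the O(a_l) to T. *)
Lemma frame_det_form a Y j : Y *m gpow4 = 0 -> local_frame a Y ->
    \det (frame Y (delta_mx 0 j)) != 0 ->
  exists m P, [/\ m%:Z = d%:Z - \sum_l a l, P \is m.-homog, P != 0 &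
    forall i, \det (frame Y (delta_mx 0 i)) = tofrac P * g i ^+ 4].
Proof.
move=> Yq hY hj.
have Gj : G j != 0.
  apply: contraNneq hj => Gj; have [i Gi] := exists_nonzero_coord.
  have := frame_det j i Yq; rewrite Gj tofrac0 expr0n /= mulr0 => /eqP.
  by rewrite mulf_eq0 expf_eq0 tofrac_eq0 (negbTE Gi) orbF.
have gj : g j ^+ 4 != 0 by apply: expf_neq0; rewrite tofrac_eq0.
pose f := \det (frame Y (delta_mx 0 j)) / g j ^+ 4.
have fE i : \det (frame Y (delta_mx 0 i)) = f * g i ^+ 4.
  by rewrite mulrAC (frame_det j i Yq) mulfK.
have f0 : f != 0 by apply: (mulf_neq0 hj); rewrite invr_eq0; exact: gj.
have [p hp|m [P [mE hP fP]]] := @global_section _ (d%:Z - \sum_l a l) f _ f0.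
  have [i Gi] := G_nonzero hp.
  have gi : g i ^+ 4 != 0 by apply: expf_neq0; apply: tofrac_neq0 Gi.
  have -> : f = \det (frame Y (delta_mx 0 i)) / g i ^+ 4 by rewrite fE mulfK.
  have -> : d%:Z - \sum_l a l = ((d * 5)%N%:Z - \sum_l a l) - (d * 4)%N%:Z by lia.
  apply: O_stalkM; first exact: frame_det_stalk.
  rewrite -tofracXn; apply: O_stalk_polyV; first exact: dhomogMn.
  by rewrite rmorphXn /= expf_neq0.
exists m, P; split=> //; first by rewrite -tofrac_eq0 -fP.
by move=> i; rewrite fE fP.
Qed.

Lemma frame_free Y j (c : 'rV[K]_4) : Y *m gpow4 = 0 ->
    \det (frame Y (delta_mx 0 j)) != 0 -> field_of (c *m Y) = 0 -> c = 0.
Proof.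
move=> Yq hj cY; have [i Gi] := exists_nonzero_coord.
have E := field_of_eq0 Gi cY.
set x := _ / _ in E.
pose v : 'rV[K]_(4 + (1 + 1)) := row_mx c (row_mx (- x)%:M 0).
have v0 : v *m frame Y (delta_mx 0 j) = 0.
  rewrite /frame /v (@mul_row_col _ 1 4 2 6) (@mul_row_col _ 1 1 1 6) mul0mx addr0.
  by rewrite mul_scalar_mx E scaleNr subrr.
have [-> //|c0] := eqVneq c 0.
case/negP: hj; apply/det0P; exists v => //.
apply: contraNneq c0 => /(congr1 (@lsubmx _ 1 4 (1 + 1))).
by rewrite row_mxKl linear0 => ->.
Qed.

Lemma field_ofZ (x : K) A : field_of (x *: A) = x *: field_of A.
Proof.
apply/matrixP => j i; rewrite !mxE; case: ifP => _; first by rewrite mulr0.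
by rewrite wedge_linear.
Qed.

Lemma field_of_eq A B : field_of A = field_of B -> exists x, A = B + x *: gvec.
Proof.
move=> AB; have [j Gj] := exists_nonzero_coord.
exists ((A - B) 0 j / g j); rewrite -(field_of_eq0 Gj) ?field_ofB ?AB ?subrr //.
by rewrite addrC subrK.
Qed.

Lemma sumO_stalk_delta (a : 'I_4 -> int) p l (u : K) : P1_point p -> O_stalk (a l) p u ->
  sumO_stalk a p (u *: delta_mx 0 l : 'rV_4).
Proof.
move=> hp hu i; rewrite !mxE eqxx /=; case: eqVneq => [->|_]; first by rewrite mulr1.
by rewrite mulr0; apply: O_stalk0.
Qed.

(* Every vector of the kernel at p extends to a regular field, hence the lifts *)
(* of a splitting span the kernel generically and the frame is invertible.     *)
Lemma splitting_frame (a : 'I_4 -> int) :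
  tangent_splitting (fermat_quintic k) G a ->
  exists Y, [/\ Y *m gpow4 = 0, local_frame a Y,
    exists j, \det (frame Y (delta_mx 0 j)) != 0 &
    forall p V, P1_point p -> pullback_tangent_stalk (fermat_quintic k) G p V ->
      exists c, sumO_stalk a p c /\ V = field_of (c *m Y)].
Proof.
case=> Theta hTheta.
have scaled p l : P1_point p -> exists u : K, [/\ u != 0, O_stalk (- a l) p u^-1 &
    pullback_tangent_stalk (fermat_quintic k) G p (u *: Theta l)].
  move=> hp; have [u [u0 hu hu']] := O_stalk_unit (a l) hp; exists u; split=> //.
  have [/(_ _ (sumO_stalk_delta hp hu)) h _] := hTheta p hp.
  move: h; rewrite (bigD1 l) //= big1 ?addr0; first by rewrite !mxE !eqxx mulr1.
  by move=> i /negbTE il; rewrite !mxE il andbF mulr0 scale0r.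
have [y hy] : exists y : 'I_4 -> 'rV[K]_6,
    forall l, y l *m gpow4 = 0 /\ Theta l = field_of (y l).
  apply: (@fin_all_exists _ _ (fun l v => v *m gpow4 = 0 /\ Theta l = field_of v)) => l.
  have hp : @P1_point k (fun=> 1) by exists ord0; apply: oner_neq0.
  have [u [u0 _ [hu _]]] := scaled _ l hp; have [j Gj] := exists_nonzero_coord.
  exists (u^-1 *: lift_at j (u *: Theta l)).
  rewrite -scalemxAl (lift_at_gpow4 Gj hu) scaler0; split=> //.
  by rewrite field_ofZ (lift_atK Gj hu) scalerK.
pose Y : 'M[K]_(4, 6) := \matrix_l y l.
have rowY l : row l Y = y l by rewrite rowK.
have YTheta c : field_of (c *m Y) = \sum_l c 0 l *: Theta l.
  by rewrite field_of_mul; apply: eq_bigr => l _; rewrite rowY -(hy l).2.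
have Yq : Y *m gpow4 = 0.
  by apply/row_matrixP => l; rewrite row_mul rowY (hy l).1 row0.
exists Y; split=> //.
- move=> p hp; have [j Gjp] := G_nonzero hp.
  have Gj : G j != 0 by apply: contraNneq Gjp => ->; rewrite meval0.
  have [x hx] : exists x : 'I_4 -> K,
      forall l i, O_stalk (d%:Z - a l) p ((row l Y + x l *: gvec) 0 i).
    apply: (@fin_all_exists _ _
      (fun l x => forall i, O_stalk (d%:Z - a l) p ((row l Y + x *: gvec) 0 i))) => l.
    have [u [u0 hu' hu]] := scaled p l hp.
    have := lift_atK Gj hu.1; rewrite (hy l).2 -rowY -field_ofZ.
    case/field_of_eq => x E; exists (u^-1 * x) => i.
    have -> : row l Y + (u^-1 * x) *: gvec = u^-1 *: lift_at j (u *: Theta l).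
      by rewrite (hy l).2 -rowY -field_ofZ E scalerDr !scalerA mulVf // scale1r.
    rewrite mxE addrC; apply: O_stalkM => //.
    exact: lift_at_stalk.
  exists (\col_l x l) => l i; have := hx l i.
  by rewrite !mxE big_ord1 !mxE.
- have hp : @P1_point k (fun=> 1) by exists ord0; apply: oner_neq0.
  move: (fun=> 1) hp => p hp; have [j Gjp] := G_nonzero hp.
  have Gj : G j != 0 by apply: contraNneq Gjp => ->; rewrite meval0.
  have gj : g j != 0 by rewrite tofrac_eq0.
  exists j; rewrite -unitfE -unitmxE.
  have [v hv] : exists v : 'I_6 -> 'rV[K]_6,
      forall i, v i *m frame Y (delta_mx 0 j) = delta_mx 0 i.
    apply: (@fin_all_exists _ _
      (fun i (v : 'rV_6) => v *m frame Y (delta_mx 0 j) = delta_mx 0 i)) => i.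
    have [u [u0 hu _]] := O_stalk_unit d%:Z hp.
    pose r := (g i / g j) ^+ 4.
    pose w : 'rV[K]_6 := u *: (delta_mx 0 i - r *: delta_mx 0 j).
    have wq : w *m gpow4 = 0.
      rewrite /w -scalemxAl mulmxBl -scalemxAl -!rowE; apply/eqP.
      rewrite scaler_eq0 (negbTE u0) /=; apply/eqP/matrixP => a' b.
      by rewrite !mxE /r (fourth_power_quotient _ gj).
    have hw m : O_stalk d p (w 0 m).
      rewrite mxE -[X in O_stalk X]addr0; apply: O_stalkM => //.
      have O01 (b : bool) : O_stalk 0 p (b%:R : K).
        by case: b; [apply: O_stalk1|apply: O_stalk0].
      rewrite !mxE; apply: O_stalkB; first exact: O01.
      rewrite -[0]addr0; apply: O_stalkM; last exact: O01.
      rewrite -[0](mul0rn _ 4); apply: O_stalkX; rewrite -(subrr d%:Z).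
      by apply: O_stalkM; [apply: O_stalk_poly|apply: O_stalk_polyV].
    have [_ /(_ _ (field_of_stalk hp wq hw)) [c [[_]]]] := hTheta p hp.
    rewrite -YTheta => /field_of_eq [x wE] _.
    exists (row_mx (u^-1 *: c) (row_mx (u^-1 * x)%:M r%:M) : 'rV_(4 + (1 + 1))).
    rewrite /frame (@mul_row_col _ 1 4 2 6) (@mul_row_col _ 1 1 1 6) !mul_scalar_mx.
    rewrite -scalemxAl -scalerA addrA -scalerDr -wE /w scalerA mulVf // scale1r.
    by rewrite subrK.
  have /mulmx1_unit [] // : (\matrix_i v i : 'M[K]_6) *m frame Y (delta_mx 0 j) = 1%:M.
  by apply/row_matrixP => i; rewrite row_mul rowK hv row1.
- move=> p V hp hV; have [_ /(_ V hV) [c [[hc Vc] _]]] := hTheta p hp.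
  by exists c; rewrite YTheta.
Qed.

(** When sum a_l = d the form given by [frame_det_form] is a nonzero constant. At each point the
    frame, made regular by adding multiples of G, then has determinant a constant times g_i^4, and
    Cramer's rule shows that the coordinates of a regular field are regular. *)
Lemma frame_splitting (a : 'I_4 -> int) Y j :
    Y *m gpow4 = 0 -> local_frame a Y -> \det (frame Y (delta_mx 0 j)) != 0 ->
    \sum_l a l = d%:Z ->
  tangent_splitting (fermat_quintic k) G a.
Proof.
move=> Yq hY hj suma; exists (fun l => field_of (row l Y)) => p hp.
have [x hx] := hY p hp; pose Y' := Y + x *m gvec.
have Y'q : Y' *m gpow4 = 0 by rewrite mulmxDl Yq -mulmxA gvec_gpow4 mulmx0 addr0.
have fieldY (c : 'rV_4) : field_of (c *m Y') = \sum_l c 0 l *: field_of (row l Y).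
  rewrite -field_of_mul mulmxDr mulmxA [c *m x]mx11_scalar mul_scalar_mx.
  exact: field_of_shift.
split=> [c hc|V hV].
  rewrite -fieldY; apply: field_of_stalk => // [|i].
    by rewrite -mulmxA Y'q mulmx0.
  rewrite mxE; apply: O_stalk_sum => // l _.
  have -> : d%:Z = a l + (d%:Z - a l) by lia.
  by apply: O_stalkM; [exact: hc|exact: hx].
have [i Gip] := G_nonzero hp.
have Gi : G i != 0 by apply: contraNneq Gip => ->; rewrite meval0.
have gi : g i != 0 by rewrite tofrac_eq0.
have [m [P [mE hP P0 detE]]] := frame_det_form Yq hY hj.
have hj' : \det (frame Y (delta_mx 0 i)) != 0.
  rewrite detE; apply: mulf_neq0; first by rewrite tofrac_eq0.
  by apply: expf_neq0; exact: gi.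
have m0 : m = 0%N by move: mE; rewrite suma subrr => -[].
subst m.
have [gamma gamma0 PE] : exists2 gamma, gamma != 0 & P = gamma%:MP.
  exists P@_0; last exact: dhomog_const.
  by apply: contraNneq P0 => c0; rewrite (dhomog_const hP) c0 mpolyC0.
set N := frame Y' (delta_mx 0 i).
have detN : \det N = tofrac P * g i ^+ 4 by rewrite /N frame_det_shift detE.
have detN0 : \det N != 0 by rewrite /N frame_det_shift; exact: hj'.
have detNV : O_stalk (- (d * 4)%N%:Z) p (\det N)^-1.
  rewrite detN invfM -tofracXn -[X in O_stalk X]add0r; apply: O_stalkM.
    rewrite -oppr0; apply: (@O_stalk_polyV _ 0) => //.
    by rewrite PE mevalC.
  apply: O_stalk_polyV; first exact: dhomogMn.
  by rewrite rmorphXn /= expf_neq0.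
pose A := lift_at i V; have hA := lift_at_stalk Gip hV.
have Aq : A *m gpow4 = 0 by apply: lift_at_gpow4 Gi hV.1.
pose y : 'rV[K]_(4 + (1 + 1)) := A *m invmx N.
have uN : N \in unitmx by rewrite unitmxE unitfE.
have AE : A = y *m N by rewrite mulmxKV.
have yE : A = lsubmx y *m Y' + (lsubmx (rsubmx y)) 0 0 *: gvec
          + (rsubmx (rsubmx y)) 0 0 *: delta_mx 0 i.
  rewrite AE -[in LHS](hsubmxK y) -[in LHS](hsubmxK (rsubmx y)) /N /frame.
  rewrite (@mul_row_col _ 1 4 2 6) (@mul_row_col _ 1 1 1 6) -!mul_scalar_mx.
  by rewrite -!mx11_scalar addrA.
(* Pairing with (G_i^4) kills the lifts and G, and leaves this coordinate times g_i^4. *)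
have last0 : (rsubmx (rsubmx y)) 0 0 = 0.
  move: Aq; rewrite yE !mulmxDl -mulmxA Y'q mulmx0 add0r -!scalemxAl gvec_gpow4 scaler0 add0r.
  rewrite -rowE => /matrixP/(_ 0 0); rewrite !mxE => /eqP.
  by rewrite mulf_eq0 expf_eq0 /= (negbTE gi) orbF => /eqP.
have VE : V = field_of (lsubmx y *m Y').
  by rewrite -[LHS](lift_atK Gi hV.1) -/A yE last0 scale0r addr0 field_of_shift.
exists (lsubmx y); split; first split.
- move=> l; rewrite mxE /y mxE; apply: O_stalk_sum => // r _.
  (* The degree a_l is d from [A], -4d from the inverse determinant, and 4d - (d - a_l) from a
     cofactor omitting row l. *)
  rewrite [X in O_stalk X](weight_split d).
  apply: O_stalkM => //.
  rewrite /invmx uN 2!mxE; apply: O_stalkM => //.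
  have hN := frame_stalk i hp hx; have := O_stalk_cofactor (lshift 2 l) r hp hN.
  by rewrite sum_weight suma /weight (@col_mxEu _ 4 2) !mxE.
- by rewrite -fieldY.
- move=> c [hc]; rewrite VE -fieldY => /eqP; rewrite -subr_eq0 -field_ofB -mulmxBl => /eqP E.
  apply/eqP; rewrite -subr_eq0; apply/eqP; refine (frame_free (j := j) Y'q _ E).
  by rewrite frame_det_shift; exact: hj.
Qed.

End Tangent.

(** * Lower bounds on the degree *)

(** Rank-nullity for [#|I|] unknowns and [#|J|] equations, with solutions kept as functions so that
    structured index types can be used. *)
Lemma independent_solutions (F : fieldType) (I J : finType) (M : I -> J -> F) :
  exists h : 'I_(#|I| - #|J|) -> I -> F,
    (forall t j, \sum_i h t i * M i j = 0) /\
    (forall c : 'I_(#|I| - #|J|) -> F,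
       (forall i, \sum_t c t * h t i = 0) -> forall t, c t = 0).
Proof.
pose B : 'M[F]_(#|I|, #|J|) := \matrix_(a, b) M (enum_val a) (enum_val b).
pose R := row_base (kermx B).
have le_n : (#|I| - #|J| <= \rank (kermx B))%N.
  by rewrite mxrank_ker leq_sub2l // rank_leq_col.
exists (fun t i => R (widen_ord le_n t) (enum_rank i)); split=> [t j|c hc t].
  have /sub_kermxP/matrixP/(_ (widen_ord le_n t) (enum_rank j)) : (R <= kermx B)%MS.
    by rewrite eq_row_base.
  rewrite mxE [X in _ = X]mxE => E; rewrite -[RHS]E [RHS](reindex enum_rank) /=; last first.
    by exists enum_val => x _; rewrite ?enum_rankK ?enum_valK.
  by apply: eq_bigr => i _; rewrite [B _ _]mxE !enum_rankK.
(* The kernel may be larger than the number of solutions kept; the coefficients are extended by zero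
   to its whole basis. *)
pose c' : 'rV[F]_(\rank (kermx B)) :=
  \row_s if insub (val s) is Some t then c t else 0.
have c'w u : c' 0 (widen_ord le_n u) = c u by rewrite mxE /= valK.
have c'R : c' *m R = 0.
  apply/rowP => a; rewrite mxE [RHS]mxE -[RHS](hc (enum_val a)).
  rewrite (bigID (fun s : 'I_(\rank (kermx B)) => (s < #|I| - #|J|)%N)) /= addrC big1 ?add0r.
    rewrite (big_ord_narrow le_n); apply: eq_bigr => u _.
    by rewrite c'w enum_valK.
  by move=> s hs; rewrite mxE insubF ?mul0r //; apply/negbTE.
have : c' *m R = 0 *m R by rewrite mul0mx.
by move/(row_free_inj (row_base_free _)) => c'0; rewrite -c'w c'0 mxE.
Qed.

Lemma homogenize_sum (k : closedFieldType) (I : finType) m (c : I -> k) (u : I -> {poly k}) :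
  homogenize m (\sum_s c s *: u s) = \sum_s c s *: homogenize m (u s).
Proof.
rewrite /homogenize; under [RHS]eq_bigr => s _ do rewrite scaler_sumr.
rewrite exchange_big; apply: eq_bigr => i _ /=.
rewrite coef_sum scaler_suml; apply: eq_bigr => s _.
by rewrite coefZ scalerA.
Qed.

Lemma sum_pow4 (R : comNzRingType) (I : Type) (r : seq I) (F : I -> R) :
  2%N \in [pchar R] -> (\sum_(i <- r) F i) ^+ 4 = \sum_(i <- r) F i ^+ 4.
Proof.
move=> h2; have sum_pow2 (H : I -> R) : (\sum_(i <- r) H i) ^+ 2 = \sum_(i <- r) H i ^+ 2.
  exact: (rmorph_sum (pFrobenius_aut h2)).
rewrite (exprM _ 2 2) !sum_pow2.
by apply: eq_bigr => i _; rewrite -exprM.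
Qed.

Lemma comp_poly_sum (R : nzRingType) (I : Type) (r : seq I) (F : I -> {poly R}) (q : {poly R}) :
  (\sum_(i <- r) F i) \Po q = \sum_(i <- r) (F i \Po q).
Proof. exact: (raddf_sum (comp_poly q)). Qed.

(** For distinct rho < 4 the exponents lie in distinct classes modulo 4, so polynomials of this
    shape never cancel one another. *)
Lemma coef_interleave (R : nzRingType) (u : {poly R}) (rho r : 'I_4) j :
  ('X^rho * (u \Po 'X^4))`_(4 * j + r) = if rho == r then u`_j else 0.
Proof.
rewrite coefXnM coef_comp_poly_Xn //; case: eqVneq => [<-|].
  by rewrite ltnNge leq_addl addnK dvdn_mulr //= mulKn.
rewrite -(inj_eq val_inj) /=; case: rho r => [x hx] [y hy] /= xy.
case: ltnP => // h; case: ifP => // /dvdnP [q E]; lia.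
Qed.

Section Sections.
Variable k : closedFieldType.
Hypothesis hk : 2%N \in [pchar k].
Variables (d : nat) (G : 'I_6 -> {mpoly k[2]}).
Hypothesis G_homog : forall i, G i \is d.-homog.
Hypothesis G_fermat : \sum_i G i ^+ 5 = 0.
Hypothesis G_nonzero : forall p, P1_point p -> exists j, (G j).@[p] != 0.
Variable a : 'I_4 -> int.
Hypothesis splitting : tangent_splitting (fermat_quintic k) G a.

Local Notation K := (coneField k).
Local Notation g i := (tofrac (G i)).

Lemma sum_splitting_le : \sum_l a l <= d%:Z.
Proof.
have [Y [Yq hY [j hj] _]] := splitting_frame hk G_homog G_fermat G_nonzero splitting.
have [m [P [mE _ _ _]]] := frame_det_form hk G_homog G_fermat G_nonzero Yq hY hj.
by rewrite -subr_ge0 -mE.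
Qed.

(* dim H^0(O(a_l - m)) *)
Definition twist_dim (m : nat) (l : 'I_4) : nat :=
  if m%:Z <= a l then (absz (a l - m%:Z)).+1 else 0.

(** The kernel of H^0(E(-m)) -> H^0(T(-m)) is H^0(O(-m)), which vanishes for m > 0, so independent
    vectors [A s] stay independent in a space of dimension sum h^0(O(a_l - m)). *)
Lemma section_bound (I : finType) e m (A : I -> 'I_6 -> {mpoly k[2]}) :
    (e + m = d)%N -> (0 < m)%N ->
    (forall s i, A s i \is e.-homog) ->
    (forall s, \sum_i A s i * G i ^+ 4 = 0) ->
    (forall c : I -> k, (forall i, \sum_s c s *: A s i = 0) -> forall s, c s = 0) ->
  (#|I| <= \sum_l twist_dim m l)%N.
Proof.
move=> em m0 hA Aq Afree.
have [Y [Yq hY [j hj] Ysurj]] := splitting_frame hk G_homog G_fermat G_nonzero splitting.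
pose v s : 'rV[K]_6 := \row_i tofrac (A s i).
have vq s : v s *m gpow4 G = 0.
  apply/matrixP => x y; rewrite !mxE; under eq_bigr => i _ do rewrite !mxE -tofracXn -tofracM.
  by rewrite -rmorph_sum /= Aq tofrac0.
(* [A s] has degree d - m; a local unit of O(m) turns it into a regular lift at [p], and its inverse
   shifts the coordinates back. *)
have coords s p : P1_point p -> exists c : 'rV[K]_4,
    (forall l, O_stalk (a l - m%:Z) p (c 0 l)) /\ field_of G (v s) = field_of G (c *m Y).
  move=> hp; have [u [u0 hu hu']] := O_stalk_unit m%:Z hp.
  have hw i : O_stalk d%:Z p ((u *: v s) 0 i).
    by rewrite -em addnC PoszD !mxE; apply: O_stalkM => //; apply: O_stalk_poly.
  have wq : (u *: v s) *m gpow4 G = 0 by rewrite -scalemxAl vq scaler0.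
  have [c [hc cE]] := Ysurj p _ hp (field_of_stalk hk G_homog G_fermat hp wq hw).
  exists (u^-1 *: c); split=> [l|].
    by rewrite mxE addrC; apply: O_stalkM.
  by rewrite -scalemxAl field_ofZ -cE field_ofZ scalerA mulVf // scale1r.
(* Coordinates in the frame are unique, so those found at different points agree and are global
   sections of O(a_l - m). *)
have [c hc] : exists c : I -> 'rV[K]_4, forall s,
    (forall l p, P1_point p -> O_stalk (a l - m%:Z) p (c s 0 l)) /\
    field_of G (v s) = field_of G (c s *m Y).
  apply: (@fin_all_exists _ _ (fun s (c : 'rV[K]_4) =>
    (forall l p, P1_point p -> O_stalk (a l - m%:Z) p (c 0 l)) /\
    field_of G (v s) = field_of G (c *m Y))) => s.
  have hp0 : @P1_point k (fun=> 1) by exists ord0; apply: oner_neq0.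
  have [c [_ cE]] := coords s _ hp0; exists c; split=> // l p hp.
  have [c' [hc' c'E]] := coords s p hp.
  suff -> : c = c' by exact: hc'.
  apply/eqP; rewrite -subr_eq0; apply/eqP.
  apply: (frame_free G_nonzero Yq hj).
  by rewrite mulmxBl field_ofB -cE -c'E subrr.
have [u hu] : exists u : I -> 'I_4 -> {poly k}, forall s l,
    (size (u s l) <= twist_dim m l)%N /\
    c s 0 l = tofrac (homogenize (twist_dim m l).-1 (u s l)).
  apply: (@fin_all_exists _ _ (fun s (u : 'I_4 -> {poly k}) => forall l,
    (size (u l) <= twist_dim m l)%N /\
    c s 0 l = tofrac (homogenize (twist_dim m l).-1 (u l)))) => s.
  apply: (@fin_all_exists _ _ (fun l (u : {poly k}) =>
    (size u <= twist_dim m l)%N /\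
    c s 0 l = tofrac (homogenize (twist_dim m l).-1 u))) => l.
  have [c0|c0] := eqVneq (c s 0 l) 0.
    by exists 0; rewrite size_poly0 homogenize0 c0 tofrac0.
  have [n [P [nE hP cP]]] := global_section (fun p hp => (hc s).1 l p hp) c0.
  have -> : twist_dim m l = n.+1.
    by rewrite /twist_dim -nE -[m%:Z <= _]subr_ge0 -nE.
  exists (dehomogenize P); split; first exact: size_dehomogenize.
  by rewrite dehomogenizeK.
rewrite leqNgt; apply/negP => lt_I.
pose J : finType := {l : 'I_4 & 'I_(twist_dim m l)}.
have cardJ : #|J| = (\sum_l twist_dim m l)%N.
  rewrite /J card_tagged sumnE big_map big_enum /=.
  by apply: eq_bigr => l _; rewrite card_ord.
(* With more vectors than coefficients, some nontrivial combination [b] has all its coordinates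
   zero, hence is a multiple x G. *)
have [h [hM hfree]] := independent_solutions (fun s (x : J) => (u s (tag x))`_(tagged x)).
have lt0 : (0 < #|I| - #|J|)%N by rewrite subn_gt0 cardJ.
pose t0 := Ordinal lt0; pose b := h t0.
have bu l : \sum_s b s *: u s l = 0.
  apply/polyP => i; rewrite coef_sum coef0.
  under eq_bigr => s _ do rewrite coefZ.
  have [lt_i|ge_i] := ltnP i (twist_dim m l).
    exact: (hM t0 (@Tagged _ l (fun l => 'I_(twist_dim m l)) (Ordinal lt_i))).
  by rewrite big1 // => s _; rewrite nth_default ?mulr0 // (leq_trans (hu s l).1).
have bc : \sum_s tofrac (b s)%:MP *: c s = 0 :> 'rV[K]_4.
  apply/rowP => l; rewrite summxE [RHS]mxE.
  under eq_bigr => s _ do rewrite mxE (hu s l).2 -tofracM mul_mpolyC.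
  by rewrite -rmorph_sum /= -homogenize_sum bu homogenize0 tofrac0.
have bv : field_of G (\sum_s tofrac (b s)%:MP *: v s) = 0.
  have lin (w : I -> 'rV[K]_6) : field_of G (\sum_s tofrac (b s)%:MP *: w s) =
      \sum_s tofrac (b s)%:MP *: field_of G (w s).
    elim/big_rec2: _ => [|s x y _ <-]; first exact: field_of0.
    by rewrite -field_ofZ field_ofD.
  rewrite lin; under eq_bigr => s _ do rewrite (hc s).2.
  rewrite -(lin (fun s => c s *m Y)).
  under eq_bigr => s _ do rewrite scalemxAl.
  by rewrite -mulmx_suml bc mul0mx field_of0.
have [i0 Gi0] := exists_nonzero_coord G_nonzero.
have vE := field_of_eq0 Gi0 bv.
move: (_ / _) vE => x vE.
have vEi i : \sum_s tofrac (b s)%:MP * tofrac (A s i) = x * g i.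
  move/rowP/(_ i): vE; rewrite summxE [RHS]mxE [gvec _ _ _]mxE => E.
  refine (etrans _ E).
  by apply: eq_bigr => s _; rewrite !mxE.
(* Dividing by a coordinate of G nonzero at the point shows that [x] is a global section of
   O(-m). *)
have x0 : x = 0.
  apply: (@global_section_neg _ (- m%:Z)) => [p hp|]; last by rewrite oppr_lt0.
  have [i Gip] := G_nonzero hp.
  have gi := tofrac_neq0 Gip.
  have -> : x = (\sum_s tofrac (b s)%:MP * tofrac (A s i)) / g i by rewrite vEi mulfK.
  have -> : - m%:Z = e%:Z - d%:Z by rewrite -em PoszD opprD addrA subrr sub0r.
  apply: O_stalkM; last exact: O_stalk_polyV.
  apply: O_stalk_sum => // s _; rewrite -tofracM mul_mpolyC.
  by apply: O_stalk_poly; apply: rpredZ.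
have b0 s : b s = 0.
  apply: Afree => i; apply/eqP; rewrite -tofrac_eq0 rmorph_sum /=; apply/eqP.
  have E : \sum_s tofrac (b s)%:MP * tofrac (A s i) = 0 by rewrite vEi x0 mul0r.
  rewrite -[RHS]E.
  by apply: eq_bigr => s' _; rewrite -mul_mpolyC tofracM.
have := hfree (fun t => (t == t0)%:R) _ t0; rewrite eqxx => h1.
have /eqP := oner_neq0 k; apply; apply: h1 => s.
rewrite (bigD1 t0) //= big1 ?addr0 => [|t /negbTE ->]; last by rewrite mul0r.
by rewrite mul1r; exact: b0.
Qed.

(** * Syzygies of the Frobenius twists *)

Local Notation P i := (dehomogenize (G i)).

(* The Frobenius twist of G_i, in the affine coordinate s / t. *)
Definition twist i : {poly k} := \poly_(j < d.+1) (P i)`_j ^+ 4.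

Lemma twistE i : P i ^+ 4 = twist i \Po 'X^4.
Proof.
have h2 : 2%N \in [pchar {poly k}] by rewrite pchar_poly.
have {1}-> : P i = \poly_(j < d.+1) (P i)`_j.
  apply/polyP => j; rewrite coef_poly; case: ltnP => // hj.
  by rewrite nth_default // (leq_trans (size_dehomogenize (G_homog i))).
rewrite poly_def sum_pow4 // /twist poly_def comp_poly_sum.
apply: eq_bigr => j _.
by rewrite exprZn comp_polyZ comp_Xn_poly -!exprM mulnC.
Qed.

(** Substituting X^4 into a syzygy of the twists and multiplying by X^rho gives a vector killed by
    the fourth powers. By [coef_interleave], independence has to be checked only within each value
    of rho. *)
Lemma section_count (I : finType) e m (rho : I -> 'I_4) (h : I -> 'I_6 -> {poly k}) :
    (e + m = d)%N -> (0 < m)%N ->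
    (forall t i, rho t + 4 * (size (h t i)).-1 <= e)%N ->
    (forall t, \sum_i h t i * twist i = 0) ->
    (forall c : I -> k,
      (forall (r : 'I_4) i, \sum_(t | rho t == r) c t *: h t i = 0) -> forall t, c t = 0) ->
  (#|I| <= \sum_l twist_dim m l)%N.
Proof.
move=> em m0 he hrel hfree.
pose A t i := homogenize e ('X^(rho t) * (h t i \Po 'X^4)).
have hsize t i : (size ('X^(rho t) * (h t i \Po 'X^4))%R <= e.+1)%N.
  apply/leq_sizeP => j hj; rewrite coefXnM; case: ltnP => // hrj.
  rewrite coef_comp_poly_Xn //; case: ifP => // dvd4.
  apply: nth_default; have := he t i; move: dvd4 => /dvdnP [q E]; rewrite E mulnK //.
  move: hj hrj E; move: (nat_of_ord (rho t)) (size (h t i)) => x y; lia.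
apply: (section_bound (A := A) em m0) => [s i|s|c hc].
- exact: homogenize_homog.
- apply: (@dehomogenize_inj _ (e + d * 4)).
  + by apply: rpred_sum => i _; apply: dhomogM; [apply: homogenize_homog|apply: dhomogMn].
  + exact: dhomog0.
  rewrite dehomogenize_sum rmorph0.
  under eq_bigr => i _ do rewrite rmorphM rmorphXn /= homogenizeK // twistE -mulrA -comp_polyM.
  by rewrite -mulr_sumr -comp_poly_sum hrel comp_poly0 mulr0.
- apply: hfree => r i; apply/polyP => j; rewrite coef0 coef_sum.
  have /(congr1 (fun Q => (dehomogenize Q)`_(4 * j + r))) := hc i.
  rewrite dehomogenize_sum rmorph0 coef0 coef_sum => E; rewrite -[RHS]E.
  rewrite big_mkcond /=; apply: eq_bigr => t _.
  rewrite dehomogenizeZ homogenizeK // !coefZ coef_interleave.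
  by case: ifP => _; rewrite ?mulr0 ?coef0.
Qed.

(* 5 q + 5 - d = 6 (q + 1) - (d + q + 1): unknown minus required coefficients. *)
Lemma syzygies q : exists h : 'I_(5 * q + 5 - d) -> 'I_6 -> {poly k},
  [/\ forall t i, (size (h t i) <= q.+1)%N,
      forall t, \sum_i h t i * twist i = 0
    & forall c : _ -> k, (forall i, \sum_t c t *: h t i = 0) -> forall t, c t = 0].
Proof.
pose I : finType := ('I_6 * 'I_q.+1)%type; pose J : finType := 'I_(d + q.+1).
have := independent_solutions (fun (x : I) (j : J) => ('X^(x.2) * twist x.1)`_j).
have -> : (#|I| - #|J| = 5 * q + 5 - d)%N by rewrite card_prod !card_ord; lia.
case=> h0 [hM hfree].
exists (fun t i => \poly_(s < q.+1) h0 t (i, inord s)); split=> [t i|t|c hc].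
- exact: size_poly.
- apply/polyP => j; rewrite coef_sum coef0.
  have [lt_j|ge_j] := ltnP j (d + q.+1); last first.
    rewrite big1 // => i _; apply: nth_default; apply: leq_trans ge_j.
    apply: (leq_trans (size_polyMleq _ _)).
    have := size_poly q.+1 (fun s => h0 t (i, inord s)).
    have := size_poly d.+1 (fun j => (P i)`_j ^+ 4); rewrite -/(twist i).
    by move: (size _) (size _) => x y; lia.
  rewrite -[RHS](hM t (Ordinal lt_j)) /=.
  transitivity (\sum_i \sum_(s < q.+1) h0 t (i, s) * ('X^s * twist i)`_j).
    apply: eq_bigr => i _; rewrite poly_def mulr_suml coef_sum; apply: eq_bigr => s _.
    by rewrite -scalerAl coefZ inord_val.
  by rewrite pair_bigA; apply: eq_bigr => -[].
- apply: hfree => -[i s]; have /(congr1 (fun p : {poly k} => p`_s)) := hc i.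
  rewrite coef0 coef_sum => E'; rewrite -[RHS]E'; apply: eq_bigr => t _.
  by rewrite coefZ coef_poly ltn_ord inord_val.
Qed.

(** Each syzygy contributes its multiples by 1, X, ..., X^s, of degree at most 4q + s = d - m. *)
Lemma syzygy_count q s n m (h : 'I_n -> 'I_6 -> {poly k}) :
    (4 * q + s + m = d)%N -> (s < 4)%N -> (0 < m)%N ->
    (forall t i, size (h t i) <= q.+1)%N ->
    (forall t, \sum_i h t i * twist i = 0) ->
    (forall c : 'I_n -> k, (forall i, \sum_t c t *: h t i = 0) -> forall t, c t = 0) ->
  (s.+1 * n <= \sum_l twist_dim m l)%N.
Proof.
move=> qsm lt_s m0 hsize hrel hfree.
have -> : (s.+1 * n = #|((('I_s.+1 * 'I_n)%type) : finType)|)%N by rewrite card_prod !card_ord.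
apply: (@section_count _ (4 * q + s) m (fun x => widen_ord lt_s x.1) (fun x => h x.2)) => //.
- move=> [r t] i /=; have := hsize t i; have := ltn_ord r; rewrite ltnS.
  by move: (size _) (nat_of_ord r) => x y; lia.
- move=> c hc [r0 t0]; apply: (hfree (fun t => c (r0, t))) => i.
  transitivity (\sum_(r | r == r0) \sum_t c (r, t) *: h t i).
    by rewrite big_pred1_eq.
  rewrite -[RHS](hc (widen_ord lt_s r0) i) pair_big.
  by apply: eq_big => [x|[r t] _] //=; rewrite andbT -!(inj_eq val_inj).
Qed.

Lemma constant_syzygy_count s n m (v : 'I_n -> 'I_6 -> k) :
    (s + m = d)%N -> (s < 4)%N -> (0 < m)%N ->
    (forall t j, (j <= d)%N -> \sum_i v t i * (P i)`_j ^+ 4 = 0) ->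
    (forall c : 'I_n -> k, (forall i, \sum_t c t * v t i = 0) -> forall t, c t = 0) ->
  (s.+1 * n <= \sum_l twist_dim m l)%N.
Proof.
move=> sm lt_s m0 hrel hfree.
apply: (@syzygy_count 0 s n m (fun t i => (v t i)%:P)) => // [t i|t|c hc].
- exact: size_polyC_leq1.
- apply/polyP => j; rewrite coef_sum coef0.
  under eq_bigr => i _ do rewrite coefCM coef_poly.
  by case: ltnP => hj; [apply: hrel|rewrite big1 // => i _; rewrite mulr0].
- apply: hfree => i; have := congr1 (fun p : {poly k} => p`_0) (hc i).
  rewrite coef0 coef_sum => E; rewrite -[RHS]E; apply: eq_bigr => t _.
  by rewrite coefZ coefC eqxx.
Qed.

(* G is itself a syzygy of (G_i^4), so its parts of fixed exponent modulo 4   *)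
(* are syzygies of the twisted forms.                                         *)
Lemma coordinate_syzygy (r : nat) j : (r < 4)%N -> (d < r + 4)%N ->
  \sum_i (P i)`_r * (P i)`_j ^+ 4 = 0.
Proof.
move=> lt_r lt_d; pose part i (r : 'I_4) : {poly k} := \poly_(n < d.+1) (P i)`_(4 * n + r).
have Psize i n : (d < n)%N -> (P i)`_n = 0.
  by move=> hn; apply: nth_default; apply: leq_trans hn; apply: size_dehomogenize.
have partE i : P i = \sum_(r < 4) 'X^r * (part i r \Po 'X^4).
  apply/polyP => n; have hn : (n %% 4 < 4)%N by rewrite ltn_pmod.
  have nE : n = (4 * (n %/ 4) + Ordinal hn)%N by rewrite /= mulnC -divn_eq.
  rewrite [in RHS]nE [RHS]coef_sum; under eq_bigr => s _ do rewrite coef_interleave.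
  rewrite -big_mkcond big_pred1_eq coef_poly -nE.
  by case: ltnP => // hd; apply: Psize; have := leq_div n 4; lia.
have E : \sum_(s < 4) 'X^s * ((\sum_i part i s * twist i) \Po 'X^4) = 0.
  have := congr1 (@dehomogenize k) G_fermat; rewrite dehomogenize_sum rmorph0 => E.
  rewrite -[RHS]E; under eq_bigr => s _ do rewrite comp_poly_sum mulr_sumr.
  rewrite exchange_big /=; apply: eq_bigr => i _.
  rewrite rmorphXn /= [RHS]exprS twistE [X in X * _]partE mulr_suml.
  by apply: eq_bigr => s _; rewrite comp_polyM mulrA.
have := congr1 (fun p : {poly k} => p`_(4 * j + Ordinal lt_r)) E.
rewrite coef0 coef_sum; under eq_bigr => s _ do rewrite coef_interleave.
rewrite -big_mkcond big_pred1_eq coef_sum => E'; rewrite -[RHS]E'.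
apply: eq_bigr => i _.
have -> : part i (Ordinal lt_r) = ((P i)`_r)%:P.
  apply/polyP => -[|n]; rewrite coef_poly coefC /= ?muln0 //.
  by case: ltnP => // hn; apply: Psize; lia.
by rewrite coefCM coef_poly; case: ltnP => // hj; rewrite (Psize i j hj) expr0n.
Qed.

(** h^0(O(a_l - 1)) = a_l when a_l >= 0. *)
Lemma sum_twist_dim1 : (forall l, 0 <= a l) -> (\sum_l twist_dim 1 l <= d)%N.
Proof.
move=> a0; rewrite -lez_nat; apply: le_trans sum_splitting_le.
rewrite (big_morph Posz PoszD (erefl 0%:Z)); apply: ler_sum => l _.
rewrite /twist_dim; have := a0 l; case: ifP => //; lia.
Qed.

(** h^0(O(a_l - 2)) = a_l - 1 when a_l > 0, once for each of the four summands. *)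
Lemma sum_twist_dim2 : (forall l, 0 < a l) -> (\sum_l twist_dim 2 l + 4 <= d)%N.
Proof.
move=> a0; rewrite -lez_nat; apply: le_trans sum_splitting_le.
have -> : (\sum_l twist_dim 2 l + 4 = \sum_l (twist_dim 2 l + 1))%N.
  by rewrite big_split sum_nat_const card_ord.
rewrite (big_morph Posz PoszD (erefl 0%:Z)); apply: ler_sum => l _.
rewrite /twist_dim; have := a0 l; case: ifP => //; lia.
Qed.

Section Free.
Hypothesis a_ge0 : forall l, 0 <= a l.

(** Each constant syzygy gives four sections of T(-1), which has at most 4, so there is at most one
    up to scalars. The coefficient vectors of G in degrees 1, 2, 3 are such syzygies by
    [coordinate_syzygy], hence all proportional. A constant syzygy is then subject to only three
    equations, those in degrees 0, 4 and r0, and 6 - 3 = 3 > 1. *)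
Lemma degree_neq4 : d != 4%N.
Proof.
apply/eqP => d4.
have count n (v : 'I_n -> 'I_6 -> k) :
    (forall t j, (j <= d)%N -> \sum_i v t i * (P i)`_j ^+ 4 = 0) ->
    (forall c : 'I_n -> k, (forall i, \sum_t c t * v t i = 0) -> forall t, c t = 0) ->
    (n <= 1)%N.
  move=> hv hfree.
  have := @constant_syzygy_count 3 n 1 v (esym d4) isT isT hv hfree.
  by have := sum_twist_dim1 a_ge0; rewrite d4; lia.
have parallel r r' i i' : (0 < r < 4)%N -> (0 < r' < 4)%N ->
    (P i)`_r * (P i')`_r' = (P i')`_r * (P i)`_r'.
  move=> hr hr'; apply/eqP; apply: contraT => ne.
  pose v (t : 'I_2) i := if t == ord0 then (P i)`_r else (P i)`_r'.
  suff : (2 <= 1)%N by [].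
  apply: (count 2 v) => [t j hj|c hc].
    rewrite /v; case: (t == ord0); apply: coordinate_syzygy; lia.
  have c2 i1 : c ord0 * (P i1)`_r + c ord_max * (P i1)`_r' = 0.
    by rewrite -[RHS](hc i1) big_ord_recr big_ord1 /v /=; congr (c _ * _ + _); apply: val_inj.
  have ne' : (P i)`_r * (P i')`_r' - (P i')`_r * (P i)`_r' != 0 by rewrite subr_eq0.
  have c00 : c ord0 = 0.
    apply: (mulIf ne'); rewrite mul0r; transitivity
      ((c ord0 * (P i)`_r + c ord_max * (P i)`_r') * (P i')`_r' -
       (c ord0 * (P i')`_r + c ord_max * (P i')`_r') * (P i)`_r'); first by ring.
    by rewrite !c2 !mul0r subr0.
  have c10 : c ord_max = 0.
    apply: (mulIf ne'); rewrite mul0r; transitivity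
      ((c ord0 * (P i')`_r + c ord_max * (P i')`_r') * (P i)`_r -
       (c ord0 * (P i)`_r + c ord_max * (P i)`_r') * (P i')`_r); first by ring.
    by rewrite !c2 !mul0r subr0.
  move=> t; case: (unliftP ord0 t) => [t'|] -> //.
  by rewrite -[RHS]c10; congr c; apply: val_inj; rewrite (ord1 t').
have [r0 [x hx]] : exists r0 (x : nat -> k),
    forall r i, (0 < r < 4)%N -> (P i)`_r = x r * (P i)`_r0.
  have [/existsP [r /andP [hr /existsP [i hi]]]|hN] :=
      boolP [exists r : 'I_4, (0 < r)%N && [exists i, (P i)`_r != 0]].
    exists r, (fun r' => (P i)`_r' / (P i)`_r) => r' i' hr'.
    apply: (mulIf hi); rewrite mulrAC divfK //.
    by rewrite (parallel r' r i' i) // hr ltn_ord.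
  (* All middle coefficients vanish: zero multipliers work with any r0. *)
  exists 0%N, (fun=> 0) => r i /andP [r0 r4]; rewrite mul0r; apply/eqP.
  move: hN; rewrite negb_exists => /forallP /(_ (Ordinal r4)) /=; rewrite r0 /=.
  by rewrite negb_exists => /forallP /(_ i); rewrite negbK.
have := independent_solutions (fun (i : 'I_6) (j : 'I_3) =>
  (P i)`_(nth 0 [:: 0; 4; r0] j)%N ^+ 4).
have -> : (#|'I_6| - #|'I_3| = 3)%N by rewrite !card_ord.
case=> h [hM hfree]; suff : (3 <= 1)%N by [].
apply: (count 3 h) => // t j hj.
have [->|j0] := eqVneq j 0%N; first exact: (hM t (@Ordinal 3 0 isT)).
have [->|j4] := eqVneq j 4%N; first exact: (hM t (@Ordinal 3 1 isT)).
have hj' : (0 < j < 4)%N by rewrite lt0n j0 ltn_neqAle j4 -d4 hj.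
transitivity (x j ^+ 4 * \sum_i h t i * (P i)`_r0 ^+ 4).
  rewrite mulr_sumr; apply: eq_bigr => i _.
  by rewrite (hx j i hj') exprMn mulrCA.
by rewrite (hM t (@Ordinal 3 2 isT)) mulr0.
Qed.

(** There is a nonzero constant syzygy [v]: the coefficient vector of G in degree 2 or 3, or, if
    both vanish, a solution of the four remaining equations in six unknowns. Five independent
    syzygies of degree 1, taken with rho = 0, and [v] with rho = 1, 2, 3 make 8 sections of T(-1),
    which has at most 5. *)
Lemma degree_neq5 : d != 5%N.
Proof.
apply/eqP => d5.
have [v [[i0 vi0] hv]] : exists v : 'I_6 -> k, (exists i, v i != 0) /\
    forall j, (j <= d)%N -> \sum_i v i * (P i)`_j ^+ 4 = 0.
  have [/existsP [i hi]|h2] := boolP [exists i, (P i)`_2 != 0].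
    by exists (fun i => (P i)`_2); split; [exists i|move=> j _; apply: coordinate_syzygy; lia].
  have [/existsP [i hi]|h3] := boolP [exists i, (P i)`_3 != 0].
    by exists (fun i => (P i)`_3); split; [exists i|move=> j _; apply: coordinate_syzygy; lia].
  have := independent_solutions (fun (i : 'I_6) (j : 'I_4) =>
    (P i)`_(nth 0 [:: 0; 1; 4; 5] j)%N ^+ 4).
  have -> : (#|'I_6| - #|'I_4| = 2)%N by rewrite !card_ord.
  case=> h [hM hfree]; exists (h ord0); split.
    apply/existsP; apply: contraT; rewrite negb_exists => /forallP h0.
    have := hfree (fun t => (t == ord0)%:R) _ ord0; rewrite eqxx => h1.
    have /eqP := oner_neq0 k; apply: contra_notT => _; apply: h1 => i.
    rewrite (bigD1 ord0) //= big1 ?addr0 => [|t /negbTE ->]; last by rewrite mul0r.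
    by rewrite mul1r; apply/eqP; have := h0 i; rewrite negbK.
  move=> j; rewrite d5 => hj.
  have zero r : ~~ [exists i, (P i)`_r != 0] -> \sum_i h ord0 i * (P i)`_r ^+ 4 = 0.
    rewrite negb_exists => /forallP hr; apply: big1 => i _.
    by have := hr i; rewrite negbK => /eqP ->; rewrite expr0n mulr0.
  case: j hj => [|[|[|[|[|[|//]]]]]] _.
  - exact: (hM _ (@Ordinal 4 0 isT)).
  - exact: (hM _ (@Ordinal 4 1 isT)).
  - exact: zero.
  - exact: zero.
  - exact: (hM _ (@Ordinal 4 2 isT)).
  - exact: (hM _ (@Ordinal 4 3 isT)).
have := syzygies 1; have -> : (5 * 1 + 5 - d = 5)%N by rewrite d5.
case=> h [hsize hrel hfree].
pose rho (x : 'I_5 + 'I_3) : 'I_4 := if x is inr r then lift ord0 r else ord0.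
pose h' (x : 'I_5 + 'I_3) i := if x is inl t then h t i else (v i)%:P.
suff : (#|{: 'I_5 + 'I_3}| <= \sum_l twist_dim 1 l)%N.
  by have := sum_twist_dim1 a_ge0; rewrite card_sum !card_ord d5; lia.
apply: (@section_count _ 4 1 rho h') => //.
- move=> [t|r] i /=.
    by have := hsize t i; move: (size _) => x; lia.
  have := size_polyC_leq1 (v i); have := ltn_ord r; rewrite /bump /=.
  by move: (size _) (nat_of_ord r) => x y; lia.
- move=> [t|r] /=; first exact: hrel.
  apply/polyP => j; rewrite coef_sum coef0.
  under eq_bigr => i _ do rewrite coefCM coef_poly.
  by case: ltnP => hj; [apply: hv|rewrite big1 // => i _; rewrite mulr0].
- move=> c hc; case=> [t|r].
    apply: (hfree (fun t => c (inl t))) => i; rewrite -[RHS](hc ord0 i) big_sumType /=.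
    rewrite [X in _ + X]big1 ?addr0 => [|r /eqP //].
    by apply: eq_bigl => s; rewrite eqxx.
  have := hc (lift ord0 r) i0; rewrite big_sumType /= big1 ?add0r => [|s]; last first.
    by move=> /eqP.
  rewrite (big_pred1 r) => [|s]; last by rewrite (inj_eq lift_inj).
  move/eqP; rewrite -mul_polyC -polyCM polyC_eq0 mulf_eq0 (negbTE vi0) orbF.
  by move/eqP.
Qed.

(** For d = 1, 2, 3, 6, 7 the inequality [count] reads 4 <= 1, 6 <= 2, 6 <= 3, 8 <= 6, 9 <= 7. *)
Lemma free_degree_ge8 : (0 < d)%N -> (8 <= d)%N.
Proof.
move=> d0; rewrite leqNgt; apply/negP => d8.
have count q s : (4 * q + s + 1 = d)%N -> (s < 4)%N ->
    (s.+1 * (5 * q + 5 - d) <= d)%N.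
  move=> qs lt_s; have [h [h1 h2 h3]] := syzygies q.
  exact: leq_trans (syzygy_count qs lt_s isT h1 h2 h3) (sum_twist_dim1 a_ge0).
have := count 0 0; have := count 0 1; have := count 0 2; have := count 1 1; have := count 1 2.
have := degree_neq4; have := degree_neq5; move: d0 d8; clear.
by case: d => [|[|[|[|[|[|[|[|//]]]]]]]] //= _ _ n5 n4 c12 c11 c02 c01 c00;
  first [by have := c00 erefl isT | by have := c01 erefl isT | by have := c02 erefl isT
        | by have := c11 erefl isT | by have := c12 erefl isT].
Qed.

End Free.

(** In degree 8, two syzygies of degree 1 times 1, X, X^2 give six sections of T(-2), which has at
    most 8 - 4 = 4. *)
Lemma very_free_degree_ge9 : (0 < d)%N -> (forall l, 0 < a l) -> (9 <= d)%N.
Proof.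
move=> d0 a0; have a_ge0 l : 0 <= a l by apply: ltW.
rewrite ltn_neqAle (free_degree_ge8 a_ge0 d0) andbT; apply/eqP => d8.
have := syzygies 1; have -> : (5 * 1 + 5 - d = 2)%N by rewrite -d8.
case=> h [h1 h2 h3].
have := @syzygy_count 1 2 2 2 h d8 isT isT h1 h2 h3.
by have := sum_twist_dim2 a0; rewrite -d8; lia.
Qed.

End Sections.

(** * Curves defined over F_2 *)

(* A binary form over the prime field F_2 is encoded by its list of exponent  *)
(* pairs, so that identities between such forms are decided by counting       *)
(* monomials modulo 2.                                                        *)
Definition exponents := seq (nat * nat).

Definition exp_mul (l1 l2 : exponents) : exponents :=
  [seq (x.1 + y.1, x.2 + y.2)%N | x <- l1, y <- l2].
Definition exp_pow4 (l : exponents) : exponents := [seq (x.1 * 4, x.2 * 4)%N | x <- l].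
Definition exp_dot (V W : seq exponents) : exponents :=
  flatten [seq exp_mul (nth [::] V i) (nth [::] W i) | i <- iota 0 6].
Definition exp_cancels (l : exponents) := all (fun x => ~~ odd (count_mem x l)) l.
Definition exp_homog e (l : exponents) := all (fun x => x.1 + x.2 == e)%N l.
Definition exp_form e (l : seq nat) : exponents := [seq (a, e - a)%N | a <- l].

Section Form.
Variable R : comNzRingType.
Hypothesis h2 : 2%N \in [pchar R].
Variables s t : R.

Definition eval_exp (l : exponents) : R := \sum_(x <- l) s ^+ x.1 * t ^+ x.2.

Lemma eval_exp_cat l1 l2 : eval_exp (l1 ++ l2) = eval_exp l1 + eval_exp l2.
Proof. exact: big_cat. Qed.

Lemma eval_exp_flatten ll : eval_exp (flatten ll) = \sum_(l <- ll) eval_exp l.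
Proof. exact: big_flatten. Qed.

Lemma eval_exp_mul l1 l2 : eval_exp (exp_mul l1 l2) = eval_exp l1 * eval_exp l2.
Proof.
rewrite /eval_exp /exp_mul big_allpairs_dep mulr_suml; apply: eq_bigr => x _.
by rewrite mulr_sumr; apply: eq_bigr => y _; rewrite !exprD mulrACA.
Qed.

Lemma eval_exp_pow4 l : eval_exp (exp_pow4 l) = eval_exp l ^+ 4.
Proof.
rewrite /eval_exp sum_pow4 // big_map; apply: eq_bigr => x _.
by rewrite exprMn -!exprM.
Qed.

Lemma eval_exp_cancels l : exp_cancels l -> eval_exp l = 0.
Proof.
move=> /allP hl; rewrite /eval_exp -big_undup_iterop_count big1_seq //= => x.
rewrite mem_undup => /hl /= even_x.
rewrite Monoid.iteropE -[count_mem x l](odd_double_half) (negbTE even_x) add0n.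
elim: (_./2) => [//|n IHn]; rewrite doubleS /= IHn addr0.
by rewrite -mulr2n -mulr_natr (pcharf0 h2) mulr0.
Qed.

Lemma eval_exp_eq l1 l2 : exp_cancels (l1 ++ l2) -> eval_exp l1 = eval_exp l2.
Proof.
move=> /eval_exp_cancels; rewrite eval_exp_cat => /(canRL (addrK _)) ->.
by rewrite sub0r oppr_pchar2.
Qed.

Lemma eval_exp_dot V W :
  \sum_(i < 6) eval_exp (nth [::] V i) * eval_exp (nth [::] W i) = eval_exp (exp_dot V W).
Proof.
rewrite -(big_mkord xpredT (fun i => eval_exp (nth [::] V i) * eval_exp (nth [::] W i))).
rewrite eval_exp_flatten big_map /index_iota subn0.
by apply: eq_bigr => i _; rewrite eval_exp_mul.
Qed.

End Form.

Lemma eval_exp_rmorph (R S : comNzRingType) (f : {rmorphism R -> S}) s t l :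
  f (eval_exp s t l) = eval_exp (f s) (f t) l.
Proof. by rewrite rmorph_sum; apply: eq_bigr => x _; rewrite rmorphM !rmorphXn. Qed.

Lemma natr_odd (R : nzRingType) n : 2%N \in [pchar R] -> n%:R = (odd n)%:R :> R.
Proof.
move=> h2; rewrite -{1}(odd_double_half n) natrD -muln2 natrM (pcharf0 h2).
by rewrite mulr0 addr0.
Qed.

Definition exp_at01 (l : exponents) := odd (count (fun x => x.1 == 0)%N l).
Definition exp_at10 (l : exponents) := odd (count (fun x => x.2 == 0)%N l).

Lemma eval_exp_at01 (R : comNzRingType) l : 2%N \in [pchar R] ->
  eval_exp (0 : R) 1 l = (exp_at01 l)%:R.
Proof.
move=> h2; rewrite -natr_odd // -sum1_count natr_sum big_mkcond /=.
apply: eq_bigr => x _; rewrite expr1n mulr1 expr0n.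
by case: (x.1 == 0)%N.
Qed.

Lemma eval_exp_at10 (R : comNzRingType) l : 2%N \in [pchar R] ->
  eval_exp (1 : R) 0 l = (exp_at10 l)%:R.
Proof.
move=> h2; rewrite -natr_odd // -sum1_count natr_sum big_mkcond /=.
apply: eq_bigr => x _; rewrite expr1n mul1r expr0n.
by case: (x.2 == 0)%N.
Qed.

Definition parity_inverse (b c : nat -> nat -> bool) :=
  all (fun i => all (fun j =>
    odd (count (fun l => b i l && c l j) (iota 0 6)) == (i == j)) (iota 0 6)) (iota 0 6).

(** An explicit inverse over F_2 certifies invertibility over every field of characteristic 2
    without expanding a determinant. *)
Lemma parity_unitmx (F : fieldType) b c : 2%N \in [pchar F] -> parity_inverse b c ->
  (\matrix_(i < 6, j < 6) (b i j)%:R : 'M[F]_6) \in unitmx.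
Proof.
move=> h2 /allP bc.
have /mulmx1_unit [] // : (\matrix_(i < 6, j < 6) (b i j)%:R : 'M[F]_6) *m
    (\matrix_(i < 6, j < 6) (c i j)%:R) = 1%:M.
apply/matrixP => i j; rewrite !mxE.
have in6 (n : 'I_6) : (n : nat) \in iota 0 6 by rewrite mem_iota ltn_ord.
have /allP /(_ j (in6 j)) /eqP E := bc i (in6 i).
transitivity ((odd (count (fun l => b i l && c l j) (iota 0 6)))%:R : F); last by rewrite E.
rewrite -natr_odd // -sum1_count natr_sum [RHS]big_mkcond.
rewrite -[iota 0 6]/(index_iota 0 6) big_mkord.
by apply: eq_bigr => l _; rewrite !mxE -natrM mulnb; case: (_ && _).
Qed.

Section Certificate.
Variable k : closedFieldType.
Hypothesis hk : 2%N \in [pchar k].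
Local Notation K := (coneField k).
Local Notation s := ('X_ord0 : {mpoly k[2]}).
Local Notation t := ('X_ord_max : {mpoly k[2]}).
Local Notation poly_of := (eval_exp s t).

Lemma pchar_mpoly : 2%N \in [pchar {mpoly k[2]}].
Proof. exact: (rmorph_pchar (@mpolyC 2 k)). Qed.
Let h2 := pchar_mpoly.

Lemma poly_of_homog e l : exp_homog e l -> poly_of l \is e.-homog.
Proof.
move=> /allP hl; rewrite /eval_exp big_seq; apply: rpred_sum => x /hl /eqP <-.
exact: dhomog_monomial.
Qed.

Lemma meval_poly_of p l : (poly_of l).@[p] = eval_exp (p ord0) (p ord_max) l.
Proof. by rewrite eval_exp_rmorph /= !mevalXU. Qed.

Definition curve (Gs : seq exponents) (i : 'I_6) : {mpoly k[2]} := poly_of (nth [::] Gs i).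

(* D decomposes G as the sum of c * H^4 over its entries (c, H), where H is a *)
(* syzygy of G, and Bs, Bt express powers of s and t in terms of G.           *)
Definition curve_certificate d (Gs : seq exponents)
    (D : seq (exponents * seq exponents)) N (Bs Bt : seq exponents) :=
  [&& all (exp_homog d) Gs, size Gs == 6,
      all (fun cH => exp_cancels (exp_dot Gs cH.2)) D,
      all (fun i => exp_cancels (nth [::] Gs i ++
        flatten [seq exp_mul cH.1 (exp_pow4 (nth [::] cH.2 i)) | cH <- D])) (iota 0 6),
      exp_cancels (exp_dot Bs Gs ++ [:: (N, 0)]%N)
    & exp_cancels (exp_dot Bt Gs ++ [:: (0, N)]%N)].

Lemma fermat_quintic_comp (G : 'I_6 -> {mpoly k[2]}) :
  fermat_quintic k \mPo [tuple G i | i < 6] = \sum_i G i ^+ 5.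
Proof.
rewrite /fermat_quintic raddf_sum /=; apply: eq_bigr => i _.
by rewrite rmorphXn /= comp_mpolyXU -tnth_nth tnth_mktuple.
Qed.

Section Curve.
Variables (d N : nat) (Gs : seq exponents) (D : seq (exponents * seq exponents)).
Variables (Bs Bt : seq exponents).
Hypothesis cert : curve_certificate d Gs D N Bs Bt.
Local Notation G := (curve Gs).

Lemma curve_homog i : G i \is d.-homog.
Proof.
have /andP [/allP hG /and5P [/eqP sG _ _ _ _]] := cert.
by apply/poly_of_homog/hG; rewrite mem_nth ?sG.
Qed.

Lemma curve_bezout : exists B B' : 'I_6 -> {mpoly k[2]},
  \sum_i B i * G i = s ^+ N /\ \sum_i B' i * G i = t ^+ N.
Proof.
have /andP [_ /and5P [_ _ _ hs ht]] := cert.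
exists (fun i => poly_of (nth [::] Bs i)), (fun i => poly_of (nth [::] Bt i)).
rewrite !eval_exp_dot (eval_exp_eq h2 _ _ hs) (eval_exp_eq h2 _ _ ht) /eval_exp !big_seq1 /=.
by rewrite !expr0 mulr1 mul1r.
Qed.

Lemma curve_nonzero p : P1_point p -> exists j, (G j).@[p] != 0.
Proof.
move=> [i pi]; apply/existsP; apply: contraT; rewrite negb_exists => /forallP Gp.
have [B [B' [hs ht]]] := curve_bezout.
have zero (C : 'I_6 -> {mpoly k[2]}) : (\sum_j C j * G j).@[p] = 0.
  rewrite raddf_sum /= big1 // => j _; rewrite mevalM.
  by have := Gp j; rewrite negbK => /eqP ->; rewrite mulr0.
have := zero B'; have := zero B; rewrite hs ht !rmorphXn /= !mevalXU => /eqP + /eqP.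
rewrite !expf_eq0 => /andP [_ /eqP p0] /andP [_ /eqP p1].
case: (unliftP ord0 i) pi => [j|] ->; last by rewrite p0 eqxx.
have -> : lift ord0 j = ord_max by apply: val_inj; rewrite (ord1 j).
by rewrite p1 eqxx.
Qed.

(** [P] divides s^N and t^N, so its leading monomial involves neither variable and [P] is a
    constant. *)
Lemma curve_primitive P : (forall i, exists Q, G i = P * Q) -> P \is a GRing.unit.
Proof.
move=> hP; have [Q hQ] := fin_all_exists hP.
have [B [B' [hs ht]]] := curve_bezout.
have factor (C : 'I_6 -> {mpoly k[2]}) : \sum_i C i * G i = P * \sum_i C i * Q i.
  by rewrite mulr_sumr; apply: eq_bigr => i _; rewrite hQ mulrCA.
have X0 i : 'X_i ^+ N != 0 :> {mpoly k[2]}.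
  by rewrite expf_neq0 // -msize_poly_eq0 msizeX.
have lead i (C : {mpoly k[2]}) : P * C = 'X_i ^+ N -> forall j, j != i -> mlead P j = 0%N.
  move=> E j ji; have E0 : P * C != 0 by rewrite E X0.
  move: (E0); rewrite mulf_eq0 negb_or => /andP [P0 C0].
  have := mleadM P0 C0; rewrite E mpolyXn mleadXm => /mnmP /(_ j).
  rewrite mulmnE mnm1E eq_sym (negbTE ji) mul0n mnmDE => /esym /eqP.
  by rewrite addn_eq0 => /andP [/eqP].
have Ps := lead _ _ (etrans (esym (factor B)) hs).
have Pt := lead _ _ (etrans (esym (factor B')) ht).
have lead0 : mlead P = 0%MM.
  apply/mnmP => j; rewrite mnm0E.
  by case: (eqVneq j ord0) => [->|/Ps //]; apply: Pt.
have P0 : P != 0.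
  by apply: contraNneq (X0 ord0) => P0; rewrite -hs factor P0 mul0r.
have /eqP := mlead_deg P0; rewrite lead0 mdeg0 eq_sym => /msize_poly1P [c c0 ->].
by rewrite rmorph_unit // unitfE.
Qed.

Lemma syzygy_sum (H : seq exponents) : exp_cancels (exp_dot Gs H) ->
  \sum_i G i * poly_of (nth [::] H i) = 0.
Proof. by move=> hH; rewrite eval_exp_dot eval_exp_cancels. Qed.

(** Expand one factor of G_i^5 as sum c H_i^4; by additivity of Frobenius, the sum over i of G_i^4
    H_i^4 is (sum G_i H_i)^4 = 0. *)
Lemma curve_fermat : \sum_i G i ^+ 5 = 0.
Proof.
have /andP [_ /and5P [_ /allP hsyz /allP hdec _ _]] := cert.
have GE (i : 'I_6) : G i = \sum_(cH <- D) poly_of cH.1 * poly_of (nth [::] cH.2 i) ^+ 4.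
  have in6 : (i : nat) \in iota 0 6 by rewrite mem_iota ltn_ord.
  rewrite /curve (eval_exp_eq h2 _ _ (hdec _ in6)) eval_exp_flatten big_map.
  by apply: eq_bigr => cH _; rewrite eval_exp_mul eval_exp_pow4.
transitivity (\sum_i \sum_(cH <- D) poly_of cH.1 * (G i * poly_of (nth [::] cH.2 i)) ^+ 4).
  apply: eq_bigr => i _; rewrite exprS {1}GE mulr_suml; apply: eq_bigr => cH _.
  by rewrite [X in _ = _ * X]exprMn [X in _ = _ * X]mulrC [RHS]mulrA.
rewrite exchange_big big1_seq //= => cH /hsyz hH.
by rewrite -mulr_sumr -sum_pow4 // syzygy_sum // expr0n mulr0.
Qed.

Lemma curve_rational (i j : 'I_6) :
  exp_at01 (nth [::] Gs i) -> exp_at10 (nth [::] Gs j) ->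
  ~~ exp_at01 (nth [::] Gs j) -> ~~ exp_at10 (nth [::] Gs i) ->
  rational_curve (fermat_quintic k) d G.
Proof.
move=> i01 j10 j01 i10; split.
- exact: curve_homog.
- exact: curve_primitive.
- by rewrite fermat_quintic_comp curve_fermat.
- pose pt (x y : k) (r : 'I_2) := if r == ord0 then x else y.
  exists (pt 0 1), (pt 1 0); split.
  + by exists ord_max; apply: oner_neq0.
  + by exists ord0; apply: oner_neq0.
  exists i, j; rewrite !meval_poly_of /pt /= !eval_exp_at01 // !eval_exp_at10 //.
  by rewrite i01 j10 (negbTE j01) (negbTE i10) mulr1 mulr0 oner_neq0.
Qed.

Variables (Hs : seq (seq exponents)) (z : nat -> K).
Hypothesis z_neq0 : forall r, z r != 0.
Hypothesis Hs_syz : all (fun H => exp_cancels (exp_dot Gs H)) Hs.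

(** Fourth powers of syzygies of G are killed by (G_i^4). The factor [z] provides the denominator t
    of one row in degree 9. *)
Definition frame_rows : 'M[K]_(4, 6) :=
  \matrix_(l, i) (z l * tofrac (poly_of (exp_pow4 (nth [::] (nth [::] Hs l) i)))).

Lemma frame_rows_gpow4 : frame_rows *m gpow4 G = 0.
Proof.
apply/matrixP => l m; rewrite mxE [RHS]mxE.
under eq_bigr => i _ do rewrite !mxE -mulrA -tofracXn -tofracM eval_exp_pow4 // -exprMn mulrC.
rewrite -mulr_suml -rmorph_sum /= -sum_pow4 //.
under eq_bigr => i _ do rewrite mulrC.
suff -> : \sum_i G i * poly_of (nth [::] (nth [::] Hs l) i) = 0.
  by rewrite expr0n tofrac0 mul0r.
have [lt_l|ge_l] := ltnP l (size Hs); first exact/syzygy_sum/(allP Hs_syz)/mem_nth.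
by rewrite big1 // => i _; rewrite (nth_default _ ge_l) nth_nil /eval_exp big_nil mulr0.
Qed.

Definition frame_entry (j r i : nat) : exponents :=
  if (r < 4)%N then exp_pow4 (nth [::] (nth [::] Hs r) i)
  else if r == 4%N then nth [::] Gs i else if i == j then [:: (0, 0)%N] else [::].

(** The nonzero factors [z] split off, and the remaining polynomial determinant is tested at
    [0 : 1], where its entries lie in F_2. *)
Lemma frame_rows_det (j : 'I_6) (c : nat -> nat -> bool) :
    parity_inverse (fun r i => exp_at01 (frame_entry j r i)) c ->
  \det (frame G frame_rows (delta_mx 0 j)) != 0.
Proof.
move=> /(parity_unitmx hk) hc.
pose M : 'M[{mpoly k[2]}]_6 := \matrix_(r, i) poly_of (frame_entry j r i).
pose z' (r : 'I_6) := if (r < 4)%N then z r else 1.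
have -> : frame G frame_rows (delta_mx 0 j) = diag_mx (\row_r z' r) *m map_mx (@tofrac _) M.
  apply/matrixP => r i; rewrite mul_diag_mx [RHS]mxE [X in X * _]mxE [X in _ * X]mxE.
  rewrite [M _ _]mxE /frame_entry /z'; case: (frame_indexP r) => [[l ->]|->|->].
  - by rewrite /frame (@col_mxEu _ 4 2) mxE /= ltn_ord.
  - by rewrite /frame (@col_mxEd _ 4 2) (@col_mxEu _ 1 1) mxE /= mul1r.
  - rewrite /frame_last /frame (@col_mxEd _ 4 2) (@col_mxEd _ 1 1) mxE /= mul1r.
    rewrite -(inj_eq val_inj) /=; case: ifP => _.
      by rewrite /eval_exp big_seq1 /= !expr0 mulr1 tofrac1.
    by rewrite /eval_exp big_nil tofrac0.
rewrite det_mulmx det_diag det_map_mx; apply: mulf_neq0.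
  apply/prodf_neq0 => r _; rewrite mxE /z'; case: ifP => _; first exact: z_neq0.
  exact: oner_neq0.
rewrite tofrac_eq0; pose p (r : 'I_2) : k := if r == ord0 then 0 else 1.
suff : (\det M).@[p] != 0 by apply: contraNneq => ->; rewrite meval0.
rewrite -det_map_mx -unitfE -unitmxE.
have -> : map_mx (meval p) M = \matrix_(r < 6, i < 6) (exp_at01 (frame_entry j r i))%:R => //.
by apply/matrixP => r i; rewrite !mxE meval_poly_of eval_exp_at01.
Qed.

End Curve.
End Certificate.

(** * The curves of degree 8 and 9 *)

Section RationalCurveFacts.
Variables (k : closedFieldType) (d : nat) (G : 'I_6 -> {mpoly k[2]}).
Hypothesis hG : rational_curve (fermat_quintic k) d G.

Lemma rational_curve_nonzero p : P1_point p -> exists j, (G j).@[p] != 0.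
Proof.
case: hG => G_homog G_primitive _ _ hp.
apply/existsP; apply: contraT; rewrite negb_exists => /forallP Gp.
have : line_at p \is a GRing.unit.
  apply: G_primitive => i; have := Gp i; rewrite negbK => /eqP Gip.
  by have [Q [E _]] := line_at_dvd hp (G_homog i) Gip; exists Q.
move=> /mulrV /(congr1 (meval p)) /eqP.
by rewrite mevalM meval_line_at mul0r meval1 eq_sym oner_eq0.
Qed.

Lemma rational_curve_fermat : \sum_i G i ^+ 5 = 0.
Proof. by case: hG => _ _ E _; rewrite -fermat_quintic_comp; exact: E. Qed.

Lemma rational_curve_degree_gt0 : (0 < d)%N.
Proof.
case: hG => G_homog _ _ [p [q [_ _ [i [j]]]]].
rewrite lt0n; apply: contraNneq => d0; move: G_homog; rewrite d0 => G_homog.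
by rewrite (dhomog_const (G_homog i)) (dhomog_const (G_homog j)) !mevalC mulrC.
Qed.

End RationalCurveFacts.

(** A multiple of x u + y v trades the pole along y = 0 for one along x = 0. *)
Lemma lift_inverse_shift (F : fieldType) (x y u v : F) : x != 0 -> y != 0 ->
  y^-1 * u + - (x * y)^-1 * (x * u + y * v) = - (x^-1 * v).
Proof. by move=> x0 y0; field; rewrite x0 y0. Qed.

Definition curve8 : seq exponents := map (exp_form 8)
  [:: [:: 7; 8]; [:: 3; 7]; [:: 3; 7; 8]; [:: 1; 5]; [:: 0; 1]; [:: 0; 1; 5]]%N.
Definition syzygies8 : seq (seq exponents) :=
  [:: map (exp_form 2) [:: [::]; [:: 0]; [::]; [:: 2]; [::]; [::]];
      map (exp_form 2) [:: [:: 0]; [::]; [:: 0]; [:: 2]; [:: 2]; [:: 2]];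
      map (exp_form 1) [:: [:: 1]; [:: 0; 1]; [:: 0; 1]; [::]; [::]; [::]];
      map (exp_form 1) [:: [::]; [::]; [::]; [:: 0; 1]; [:: 0]; [:: 0; 1]]]%N.
Definition decomposition8 : seq (exponents * seq exponents) :=
  [:: ([:: (0, 0)], map (exp_form 2) [:: [:: 2]; [::]; [:: 2]; [::]; [:: 0]; [:: 0]]);
      ([:: (3, 1)], nth [::] syzygies8 2); ([:: (1, 3)], nth [::] syzygies8 3)]%N.

(** The last two lists say s^8 = G_1 + G_2 and t^8 = G_3 + G_5. *)
Lemma curve8_certificate : curve_certificate 8 curve8 decomposition8 8
  [:: [::]; [:: (0, 0)]; [:: (0, 0)]; [::]; [::]; [::]]%N
  [:: [::]; [::]; [::]; [:: (0, 0)]; [::]; [:: (0, 0)]]%N.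
Proof. by vm_compute. Qed.

Definition curve9 : seq exponents := map (exp_form 9)
  [:: [:: 0; 5; 6]; [:: 1; 5; 6]; [:: 4; 5; 6]; [:: 0; 5; 6; 8]; [:: 2; 5; 9];
      [:: 1; 4; 5; 9]]%N.
Definition syzygies9 : seq (seq exponents) :=
  [:: map (exp_form 2) [:: [:: 1]; [:: 0; 1]; [:: 1]; [:: 1]; [:: 1; 2]; [:: 0; 1; 2]];
      map (exp_form 2) [:: [:: 1; 2]; [:: 0; 1]; [::]; [:: 2]; [::]; [:: 1]];
      map (exp_form 2) [:: [:: 2]; [:: 1]; [:: 0; 2]; [:: 1]; [::]; [:: 0]];
      map (exp_form 1) [:: [:: 1]; [:: 1]; [:: 1]; [:: 1]; [:: 0]; [::]]]%N.
Definition syzygy9 : seq exponents :=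
  map (exp_form 2) [:: [:: 0]; [::]; [:: 1]; [:: 0; 2]; [::]; [:: 1]]%N.
Definition decomposition9 : seq (exponents * seq exponents) :=
  [:: ([:: (1, 0)], nth [::] syzygies9 0); ([:: (0, 1)], syzygy9);
      ([:: (2, 3)], nth [::] syzygies9 3)]%N.

Lemma curve9_certificate : curve_certificate 9 curve9 decomposition9 10
  (map (exp_form 1) [:: [:: 1]; [:: 0; 1]; [::]; [::]; [::]; [:: 1]])%N
  (map (exp_form 1) [:: [:: 0]; [::]; [:: 0; 1]; [:: 1]; [::]; [:: 0]])%N.
Proof. by vm_compute. Qed.

Section Existence.
Variable k : closedFieldType.
Hypothesis hk : 2%N \in [pchar k].
Local Notation K := (coneField k).
Local Notation s := ('X_ord0 : {mpoly k[2]}).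
Local Notation t := ('X_ord_max : {mpoly k[2]}).
Local Notation poly_of := (eval_exp s t).

Lemma stalk_poly_of p e l : exp_homog e l -> O_stalk e%:Z p (tofrac (poly_of l)).
Proof. by move=> hl; apply: O_stalk_poly; apply: poly_of_homog. Qed.

Lemma exp_homog_pow4 e (H : seq exponents) i : all (exp_homog e) H ->
  exp_homog (e * 4)%N (exp_pow4 (nth [::] H i)).
Proof.
move=> /allP hH; apply/allP => _ /mapP [x hx ->] /=.
have [lt_i|ge_i] := ltnP i (size H); last by rewrite nth_default in hx.
have /allP /(_ x hx) /eqP <- := hH _ (mem_nth [::] lt_i).
by rewrite mulnDl.
Qed.

(* The generators of E are G itself, of weight 0, and the fourth powers of    *)
(* syzygies8, of weights 0, 0, 4, 4; killing G leaves the latter.             *)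
Lemma free_curve8 : free_curve (fermat_quintic k) (curve k curve8).
Proof.
pose a (l : 'I_4) : int := (nth 0%N [:: 0; 0; 4; 4]%N l)%:Z.
exists a; split=> //.
apply: (@frame_splitting k hk 8 (curve k curve8) (curve_homog k curve8_certificate)
  (curve_fermat hk curve8_certificate) (curve_nonzero hk curve8_certificate)
  a (frame_rows syzygies8 (fun=> 1)) (inord 4)).
- by apply: frame_rows_gpow4.
- move=> p hp; exists 0 => l i; rewrite mul0mx addr0 mxE mul1r.
  case: l => -[|[|[|[|//]]]] lt_l.
  + exact/(@stalk_poly_of p 8)/(@exp_homog_pow4 2).
  + exact/(@stalk_poly_of p 8)/(@exp_homog_pow4 2).
  + exact/(@stalk_poly_of p 4)/(@exp_homog_pow4 1).
  + exact/(@stalk_poly_of p 4)/(@exp_homog_pow4 1).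
(* The lists are the supports of the rows of the inverse over F_2; the frame uses coordinate 4,
   where G is nonzero at [0 : 1]. *)
- apply: (frame_rows_det hk (fun=> oner_neq0 _) (c := fun i l =>
    l \in nth [::] [:: [:: 0; 1; 2]; [:: 0]; [:: 0; 2]; [:: 3; 4]; [:: 5]; [:: 4; 5]]%N i)).
  by rewrite inordK //; vm_compute.
- by rewrite !big_ord_recr big_ord0.
Qed.

(* Here G = s u0 + t u1, where u0 and u1 generate the part O(1)^2 of E.  The  *)
(* quotient of O(1)^2 by (s, t) is O(2), generated by u0 / t = - u1 / s mod G. *)
Lemma very_free_curve9 : very_free_curve (fermat_quintic k) (curve k curve9).
Proof.
pose a (l : 'I_4) : int := (nth 0%N [:: 2; 1; 1; 5]%N l)%:Z.
have s0 : tofrac s != 0 by rewrite tofrac_eq0 -msize_poly_eq0 msizeX.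
have t0 : tofrac t != 0 by rewrite tofrac_eq0 -msize_poly_eq0 msizeX.
pose z (l : nat) : K := if l == 0%N then (tofrac t)^-1 else 1.
have z0 l : z l != 0.
  by rewrite /z; case: ifP => _; [rewrite invr_eq0; exact: t0 | exact: oner_neq0].
exists a; split; last by move=> [[|[|[|[|//]]]]].
apply: (@frame_splitting k hk 9 (curve k curve9) (curve_homog k curve9_certificate)
  (curve_fermat hk curve9_certificate) (curve_nonzero hk curve9_certificate)
  a (frame_rows syzygies9 z) (inord 0)).
- by apply: frame_rows_gpow4.
- move=> p hp.
  have rest (l : 'I_4) i : (0 < l)%N -> O_stalk (9 - a l) p (frame_rows syzygies9 z l i).
    rewrite mxE; case: l => -[//|[|[|[|//]]]] lt_l _; rewrite mul1r.
    + exact/(@stalk_poly_of p 8)/(@exp_homog_pow4 2).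
    + exact/(@stalk_poly_of p 8)/(@exp_homog_pow4 2).
    + exact/(@stalk_poly_of p 4)/(@exp_homog_pow4 1).
  have [pt|pt] := eqVneq (p ord_max) 0; last first.
    exists 0 => l i; rewrite mul0mx addr0.
    case: (posnP l) => [l0|]; last exact: rest.
    have -> : l = ord0 by apply: val_inj.
    rewrite mxE /z /=; apply: (@O_stalkM _ (- 1%N%:Z) 8%N%:Z).
      by apply: O_stalk_polyV; [exact: dhomog_var|rewrite mevalXU].
    exact/(@stalk_poly_of p 8)/(@exp_homog_pow4 2).
  have ps : p ord0 != 0.
    case: hp => i; case: (unliftP ord0 i) => [j|] -> //.
    have -> : lift ord0 j = ord_max by apply: val_inj; rewrite (ord1 j).
    by rewrite pt eqxx.
  exists (\col_l (if l == ord0 then - (tofrac s * tofrac t)^-1 else 0)) => l i.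
  rewrite mxE [X in O_stalk _ _ (_ + X)]mxE big_ord1 [X in O_stalk _ _ (_ + X * _)]mxE.
  case: (posnP l) => [l0|l0]; last first.
    have -> : (l == ord0) = false by apply/negbTE; rewrite -(inj_eq val_inj) -lt0n.
    by rewrite mul0r addr0; apply: rest.
  have -> : l = ord0 by apply: val_inj.
  (* This is the coordinate of u1: the last two terms of [decomposition9], divided by t. *)
  pose u := exp_pow4 (nth [::] syzygy9 i) ++
    exp_mul [:: (2, 2)]%N (exp_pow4 (nth [::] (nth [::] syzygies9 3) i)).
  have GE : curve k curve9 i =
      s * poly_of (exp_pow4 (nth [::] (nth [::] syzygies9 0) i)) + t * poly_of u.
    have sE : poly_of [:: (1, 0)]%N = s by rewrite /eval_exp big_seq1 /= expr1 expr0 mulr1.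
    have tE : poly_of [:: (0, 1)]%N = t by rewrite /eval_exp big_seq1 /= expr1 expr0 mul1r.
    rewrite -[X in X * _ + _]sE -[X in _ + X * _]tE -!eval_exp_mul -eval_exp_cat /curve.
    apply: (eval_exp_eq (pchar_mpoly hk)); rewrite /u.
    by case: (i : nat) (ltn_ord i) => [|[|[|[|[|[|//]]]]]] _; vm_compute.
  have -> : frame_rows syzygies9 z ord0 i = (tofrac t)^-1 *
      tofrac (poly_of (exp_pow4 (nth [::] (nth [::] syzygies9 0) i))) by rewrite mxE.
  rewrite [gvec _ _ _]mxE GE tofracD (tofracM s) (tofracM t) (lift_inverse_shift _ _ s0 t0).
  apply: O_stalkN; apply: (@O_stalkM _ (- 1%N%:Z) 8%N%:Z).
    by apply: O_stalk_polyV; [exact: dhomog_var|rewrite mevalXU].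
  apply: stalk_poly_of; rewrite /u.
  by case: (i : nat) (ltn_ord i) => [|[|[|[|[|[|//]]]]]] _; vm_compute.
- apply: (frame_rows_det hk z0 (c := fun i l =>
    l \in nth [::] [:: [:: 5]; [:: 1]; [:: 0; 1; 2]; [:: 4; 5]; [:: 3]; [:: 0; 1]]%N i)).
  by rewrite inordK //; vm_compute.
- by rewrite !big_ord_recr big_ord0.
Qed.

End Existence.

Theorem theorem1p1 (k : closedFieldType) (hk : 2%N \in [pchar k]) :
  ((forall (d : nat) (G : 'I_6 -> {mpoly k[2]}),
      rational_curve (fermat_quintic k) d G ->
      free_curve (fermat_quintic k) G -> (8 <= d)%N) /\
   (exists G : 'I_6 -> {mpoly k[2]},
      rational_curve (fermat_quintic k) 8 G /\
      free_curve (fermat_quintic k) G)) /\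
  ((forall (d : nat) (G : 'I_6 -> {mpoly k[2]}),
      rational_curve (fermat_quintic k) d G ->
      very_free_curve (fermat_quintic k) G -> (9 <= d)%N) /\
   (exists G : 'I_6 -> {mpoly k[2]},
      rational_curve (fermat_quintic k) 9 G /\
      very_free_curve (fermat_quintic k) G)).
Proof.
split; split.
- move=> d G hG [a [hsplit a0]]; have [G_homog _ _ _] := hG.
  exact: (free_degree_ge8 hk G_homog (rational_curve_fermat hG)
    (rational_curve_nonzero hG) hsplit a0 (rational_curve_degree_gt0 hG)).
- exists (curve k curve8); split; last exact: free_curve8.
  apply: (curve_rational hk curve8_certificate (i := inord 4) (j := inord 0));
    by rewrite !inordK.
- move=> d G hG [a [hsplit a0]]; have [G_homog _ _ _] := hG.
  exact: (very_free_degree_ge9 hk G_homog (rational_curve_fermat hG)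
    (rational_curve_nonzero hG) hsplit (rational_curve_degree_gt0 hG) a0).
- exists (curve k curve9); split; last exact: very_free_curve9.
  apply: (curve_rational hk curve9_certificate (i := inord 0) (j := inord 4));
    by rewrite !inordK.
Qed.
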